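(* (a) Let $X$ be an ergodic (equivalently, irreducible) continuous-time upward skip-free Markov chain on the state space $\{0,\dots,d\}$ with $X(0)=0$ and stochastically monotone time-reversal. Let $G$ denote the generator of $X$. Then a fastest strong stationary time $T$ for $X$ has Laplace transform $$ u \mapsto \mathbf{E}\,e^{-uT} = \prod_{j=0}^{d-1} \frac{\nu_j}{\nu_j+u}, $$ where $\nu_0,\dots,\nu_{d-1}$ are the $d$ nonzero eigenvalues of $-G$ (known to have positive real parts). In particular, if the $\nu_j$'s are real, then the distribution of the fastest strong stationary time is the convolution of the Exponential$(\nu_j)$ distributions, $j=0,\dots,d-1$. (b) Let $X$ be an ergodic (equivalently, irreducible and aperiodic) discrete-time upward skip-free Markov chain on the state space $\{0,\dots,d\}$ with $X(0)=0$ and stochastically monotone time-reversal. Let $P$ denote the transition matrix of $X$. Then a fastest strong stationary time $T$ for $X$ has probability generating function $$ u \mapsto \mathbf{E}\,u^{T} = \prod_{j=0}^{d-1} \left[ \frac{(1-\theta_j)u}{1-\theta_j u} \right], $$ where $\theta_0,\dots,\theta_{d-1}$ are the $d$ non-unit eigenvalues of $P$. In particular, if every $\theta_j$ is real and nonnegative, then the distribution of the fastest strong stationary time is the convolution of the Geometric$(1-\theta_j)$ distributions, $j=0,\dots,d-1$.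
   Context: Skip-free: a chain on $\{0,\dots,d\}$ with transition matrix $P=(p_{ij})$ (resp. generator $G=(g_{ij})$) is (upward) skip-free if $p_{ij}=0$ (resp. $g_{ij}=0$) whenever $j>i+1$; downward jumps are unrestricted. Time-reversal: with $\pi$ the stationary distribution, the time-reversal of $P$ is $\tilde P(x,y)=\pi(y)P(y,x)/\pi(x)$, and of $G$ is $\tilde G(x,y)=\pi(y)G(y,x)/\pi(x)$. A transition matrix $K$ on $\{0,\dots,d\}$ is stochastically monotone if $\sum_{y\ge z}K(x,y)\le\sum_{y\ge z}K(x',y)$ for all $z$ whenever $x\le x'$; a continuous-time chain with generator $\tilde G$ is stochastically monotone if $e^{t\tilde G}$ is stochastically monotone for every $t\ge 0$. Strong stationary time (SST): a randomized stopping time $T$ for $X$ (a stopping time whose definition may use extra randomness, with $X$ still Markov with respect to the enlarged filtration) such that $X_T$ has distribution $\pi$ and is independent of $T$, on $\{T<\infty\}$; i.e. $\mathbf{P}(T\le t, X_t=y)=\mathbf{P}(T\le t)\,\pi(y)$ for all $t,y$. A fastest SST is one that is stochastically smallest among all SSTs; as is well known, it satisfies $\mathbf{P}(T\le t)=1-s(t)$ for all $t$, where $s(t)=\max_x\left[1-\mathbf{P}(X_t=x)/\pi(x)\right]$ is the separation from stationarity at time $t$. Eigenvalues are complex and listed with algebraic multiplicity. Laplace transforms are considered for $u\ge 0$, probability generating functions for $|u|<1$. Exponential$(\nu)$ has rate $\nu$; Geometric$(p)$ is the distribution on $\{1,2,\dots\}$ with $\Pr(k)=p(1-p)^{k-1}$.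 *)

(* Defs.v *)
From HB Require Import structures.
From mathcomp Require Import all_boot all_order all_algebra.
From mathcomp Require Import all_classical all_reals all_analysis.
From mathcomp Require Import complex.

Set Implicit Arguments.
Unset Strict Implicit.
Unset Printing Implicit Defensive.

Import Order.TTheory GRing.Theory Num.Theory.
Import numFieldNormedType.Exports.

Local Open Scope classical_set_scope.
Local Open Scope ring_scope.
Local Open Scope complex_scope.

(** * Matrices *)

Definition is_transition_matrix (R : realType) (n : nat) (P : 'M[R]_n) : Prop :=
  (forall i j, 0 <= P i j) /\ (forall i, \sum_j P i j = 1).

Definition is_generator (R : realType) (n : nat) (G : 'M[R]_n) : Prop :=
  (forall i j, i != j -> 0 <= G i j) /\ (forall i, \sum_j G i j = 0).

Definition skip_free (R : realType) (n : nat) (A : 'M[R]_n) : Prop :=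
  forall i j : 'I_n, (i.+1 < j)%N -> A i j = 0.

(* The diagonal entries of a generator are nonpositive, so the same definition
   serves for transition matrices and for generators. *)
Definition irreducible (R : realType) (n : nat) (A : 'M[R]_n) : Prop :=
  forall x y : 'I_n, connect [rel i j | 0 < A i j] x y.

Definition aperiodic (R : realType) (n : nat) (P : 'M[R]_n.+1) : Prop :=
  forall (x : 'I_n.+1) (g : nat),
    (forall k : nat, (0 < k)%N -> 0 < (P ^+ k) x x -> (g %| k)%N) -> g = 1%N.

Definition is_distribution (R : realType) (n : nat) (pi : 'rV[R]_n) : Prop :=
  (forall x, 0 <= pi ord0 x) /\ \sum_x pi ord0 x = 1.

Definition stationary (R : realType) (n : nat) (P : 'M[R]_n) (pi : 'rV[R]_n) :
    Prop :=
  is_distribution pi /\ pi *m P = pi.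

Definition stationary_generator (R : realType) (n : nat) (G : 'M[R]_n)
    (pi : 'rV[R]_n) : Prop :=
  is_distribution pi /\ pi *m G = 0.

Definition time_reversal (R : realType) (n : nat) (pi : 'rV[R]_n)
    (A : 'M[R]_n) : 'M[R]_n :=
  \matrix_(x, y) (pi ord0 y * A y x / pi ord0 x).

Definition expmx (R : realType) (n : nat) (A : 'M[R]_n.+1) : 'M[R]_n.+1 :=
  \matrix_(i, j) limn (series (fun k : nat => (A ^+ k) i j / k`!%:R)).

Definition stochastically_monotone (R : realType) (n : nat) (K : 'M[R]_n) :
    Prop :=
  forall x x' z : 'I_n, (x <= x')%N ->
    \sum_(y < n | (z <= y)%N) K x y <= \sum_(y < n | (z <= y)%N) K x' y.

Definition stochastically_monotone_generator (R : realType) (n : nat)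
    (G : 'M[R]_n.+1) : Prop :=
  forall t : R, 0 <= t -> stochastically_monotone (expmx (t *: G)).

(* [s] lists the complex eigenvalues of [A] with algebraic multiplicity. *)
Definition eigenvalues (R : realType) (n : nat) (A : 'M[R]_n) (s : seq R[i]) :
    Prop :=
  char_poly (map_mx (real_complex R) A) = \prod_(z <- s) ('X - z%:P).

(** * Filtrations *)

(* In continuous time the index set is all of [R], but only indices [t >= 0]
   matter: a filtration on [[0, oo)] is extended to negative indices by any
   sub-sigma-algebra of [F 0], e.g. the trivial one. *)
Definition filtration (dI : Order.disp_t) (I : porderType dI)
    (dO : measure_display) (Om : measurableType dO) (F : I -> set (set Om)) :
    Prop :=
  [/\ forall i, sigma_algebra setT (F i),
      forall i, F i `<=` measurable
    & forall i j, (i <= j)%O -> F i `<=` F j].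

(* Generated by [X j], for [j <= i] in the time set [D]. *)
Definition natural_filtration (dI : Order.disp_t) (I : porderType dI)
    (D : set I) (dO : measure_display) (Om : measurableType dO) (S : Type)
    (X : I -> Om -> S) (i : I) : set (set Om) :=
  <<s [set A | exists j x, [/\ D j, (j <= i)%O & A = [set w | X j w = x]]] >>.

(** * Continuous time *)

(* Markov with respect to [F]: on [X s = x], the conditional probability given
   [F s] that [X t = y] is the [(x, y)] entry of [exp ((t - s) G)]. *)
Definition ct_markov (R : realType) (d : nat) (G : 'M[R]_d.+1)
    (dO : measure_display) (Om : measurableType dO) (mu : probability Om R)
    (F : R -> set (set Om)) (X : R -> Om -> 'I_d.+1) : Prop :=
  [/\ filtration F,
      forall (t : R) (x : 'I_d.+1), 0 <= t -> F t [set w | X t w = x]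
    & forall (s t : R) (A : set Om) (x y : 'I_d.+1),
        0 <= s -> s <= t -> F s A ->
        mu (A `&` [set w | X s w = x] `&` [set w | X t w = y]) =
        (mu (A `&` [set w | X s w = x]) * (expmx ((t - s) *: G) x y)%:E)%E].

Definition ct_chain_from0 (R : realType) (d : nat) (G : 'M[R]_d.+1)
    (dO : measure_display) (Om : measurableType dO) (mu : probability Om R)
    (X : R -> Om -> 'I_d.+1) : Prop :=
  ct_markov G mu (natural_filtration [set t : R | 0 <= t] X) X /\
  mu [set w | X 0 w = ord0] = 1%E.

(* The enlarged filtration [F], with respect to which [X] is still Markov,
   carries the extra randomness used by [T]; [T] may be infinite. *)
Definition ct_sst (R : realType) (d : nat) (G : 'M[R]_d.+1)
    (pi : 'rV[R]_d.+1) (dO : measure_display) (Om : measurableType dO)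
    (mu : probability Om R) (X : R -> Om -> 'I_d.+1) (T : Om -> \bar R) :
    Prop :=
  exists F : R -> set (set Om),
    [/\ ct_markov G mu F X,
        forall w, (0 <= T w)%E,
        forall t : R, 0 <= t -> F t [set w | (T w <= t%:E)%E]
      & forall (t : R) (y : 'I_d.+1), 0 <= t ->
          mu ([set w | (T w <= t%:E)%E] `&` [set w | X t w = y]) =
          (mu [set w | (T w <= t%:E)%E] * (pi ord0 y)%:E)%E].

(* As extra randomness is allowed, the competitors [T'] live on arbitrary
   probability spaces carrying a copy [X'] of the chain. *)
Definition ct_fastest_sst (R : realType) (d : nat) (G : 'M[R]_d.+1)
    (pi : 'rV[R]_d.+1) (dO : measure_display) (Om : measurableType dO)
    (mu : probability Om R) (X : R -> Om -> 'I_d.+1) (T : Om -> \bar R) :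
    Prop :=
  ct_sst G pi mu X T /\
  forall (dO' : measure_display) (Om' : measurableType dO')
    (mu' : probability Om' R) (X' : R -> Om' -> 'I_d.+1) (T' : Om' -> \bar R),
    ct_chain_from0 G mu' X' -> ct_sst G pi mu' X' T' ->
    forall t : R, 0 <= t ->
      (mu [set w | (t%:E < T w)%E] <= mu' [set w | (t%:E < T' w)%E])%E.

(* [expeR -oo = 0], so an infinite [T w] contributes [0] when [u > 0]. *)
Definition laplace (R : realType) (dO : measure_display)
    (Om : measurableType dO) (mu : probability Om R) (T : Om -> \bar R)
    (u : R) : R :=
  fine (\int[mu]_w expeR (- (u%:E * T w)))%E.

Definition convolution (R : realType) (m1 m2 : set R -> \bar R) :
    set R -> \bar R :=
  fun A => (\int[m1]_x m2 [set y | A (x + y)%R])%E.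

(** * Discrete time *)

Definition dt_markov (R : realType) (d : nat) (P : 'M[R]_d.+1)
    (dO : measure_display) (Om : measurableType dO) (mu : probability Om R)
    (F : nat -> set (set Om)) (X : nat -> Om -> 'I_d.+1) : Prop :=
  [/\ filtration F,
      forall (n : nat) (x : 'I_d.+1), F n [set w | X n w = x]
    & forall (n : nat) (A : set Om) (x y : 'I_d.+1), F n A ->
        mu (A `&` [set w | X n w = x] `&` [set w | X n.+1 w = y]) =
        (mu (A `&` [set w | X n w = x]) * (P x y)%:E)%E].

Definition dt_chain_from0 (R : realType) (d : nat) (P : 'M[R]_d.+1)
    (dO : measure_display) (Om : measurableType dO) (mu : probability Om R)
    (X : nat -> Om -> 'I_d.+1) : Prop :=
  dt_markov P mu (natural_filtration [set: nat] X) X /\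
  mu [set w | X 0%N w = ord0] = 1%E.

(* Discrete random times take values in [option nat], [None] being infinity. *)
Definition le_time (T : option nat) (n : nat) : bool :=
  if T is Some k then (k <= n)%N else false.

Definition dt_sst (R : realType) (d : nat) (P : 'M[R]_d.+1)
    (pi : 'rV[R]_d.+1) (dO : measure_display) (Om : measurableType dO)
    (mu : probability Om R) (X : nat -> Om -> 'I_d.+1) (T : Om -> option nat) :
    Prop :=
  exists F : nat -> set (set Om),
    [/\ dt_markov P mu F X,
        forall n : nat, F n [set w | le_time (T w) n]
      & forall (n : nat) (y : 'I_d.+1),
          mu ([set w | le_time (T w) n] `&` [set w | X n w = y]) =
          (mu [set w | le_time (T w) n] * (pi ord0 y)%:E)%E].

Definition dt_fastest_sst (R : realType) (d : nat) (P : 'M[R]_d.+1)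
    (pi : 'rV[R]_d.+1) (dO : measure_display) (Om : measurableType dO)
    (mu : probability Om R) (X : nat -> Om -> 'I_d.+1) (T : Om -> option nat) :
    Prop :=
  dt_sst P pi mu X T /\
  forall (dO' : measure_display) (Om' : measurableType dO')
    (mu' : probability Om' R) (X' : nat -> Om' -> 'I_d.+1)
    (T' : Om' -> option nat),
    dt_chain_from0 P mu' X' -> dt_sst P pi mu' X' T' ->
    forall n : nat,
      (mu [set w | ~~ le_time (T w) n] <= mu' [set w | ~~ le_time (T' w) n])%E.

Definition complex_expectation (R : realType) (dO : measure_display)
    (Om : measurableType dO) (mu : probability Om R) (f : Om -> R[i]) : R[i] :=
  Rintegral mu setT (fun w => complex.Re (f w)) +i*
  Rintegral mu setT (fun w => complex.Im (f w)).

(* For [|u| < 1], where [u ^ oo = 0]. *)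
Definition pgf (R : realType) (dO : measure_display)
    (Om : measurableType dO) (mu : probability Om R) (T : Om -> option nat)
    (u : R[i]) : R[i] :=
  complex_expectation mu (fun w => if T w is Some k then u ^+ k else 0).

Definition geometric_pmf (R : realType) (p : R) (k : nat) : R :=
  if k is k'.+1 then p * (1 - p) ^+ k' else 0.

Definition pmf_convolution (R : realType) (f g : nat -> R) (n : nat) : R :=
  \sum_(i < n.+1) f i * g (n - i)%N.

Definition pmf_dirac0 (R : realType) (n : nat) : R := (n == 0%N)%:R.

(* Main.v *)
Require Import Defs.
From HB Require Import structures.
From mathcomp Require Import all_boot all_order all_algebra.
From mathcomp Require Import all_classical all_reals all_analysis.
From mathcomp Require Import complex.
From mathcomp Require Import measurable_realfun.
From mathcomp Require Import ring zify.

Set Implicit Arguments.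
Unset Strict Implicit.
Unset Printing Implicit Defensive.

Import Order.TTheory GRing.Theory Num.Theory.
Import numFieldNormedType.Exports.

Local Open Scope classical_set_scope.
Local Open Scope ring_scope.
Local Open Scope complex_scope.

(** The proof rests on a formula for the distribution function of a fastest
strong stationary time, and on one algebraic identity for the generator.

Distribution function.  Write [p_t] for the law of the chain at time [t].  For
any strong stationary time [T] and any state [y],
[P(T <= t) pi(y) = P(T <= t, X_t = y) <= p_t(y)], so that
[P(T <= t) <= min_y p_t(y) / pi(y)].  The minimum is attained by a randomized
time.  Since a fastest time has to beat every competitor at every [t], it is
enough to exhibit, for each fixed [t], one competitor which is good at that [t]
alone: with [a] below the minimum and [U] uniform on [[0, 1]] and independent of
the chain, it stops at time [t] if [U <= a pi(X_t) / p_t(X_t)] and never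
otherwise; then [P(T' <= t, X_t = y) = a pi(y)], and stationarity carries this
identity to all later times.  Hence [P(T <= t) = min_y p_t(y) / pi(y)]
([dt_fastest_law], [ct_fastest_law]).  The ratio [p_t(y) / pi(y)] is
proportional to the transition probability from [y] to [0] of the reversed
chain at time [t], which is nonincreasing in [y] because the reversed chain is
stochastically monotone; so the minimum is at [y = d], and
[P(T <= t) = p_t(d) / pi(d)].

Algebra.  Let [G] be the generator ([P - 1] in discrete time), let
[nu_0, ..., nu_(d-1)] be the nonzero eigenvalues of [- G] (which are
[1 - theta_j] in discrete time), and let [e_0] be the row vector of the point
mass at [0].  Since [G] is skip-free, [e_0 (G + nu_0) ... (G + nu_(k-1))] is
supported on [{0, ..., k}].  For [k = d] the Cayley-Hamilton theorem puts it in
the left kernel of [G], which is the line spanned by [pi], and comparing the row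
sums gives

  [e_0 (G + nu_0) ... (G + nu_(d-1)) = (nu_0 ... nu_(d-1)) pi]

([generator_spectral_product]).  The entry at [d] of the left-hand side is
[g_(0,1) ... g_(d-1,d)], which is positive, so no [nu_j] vanishes.

Conclusion.  Starting from [v = e_0], replace [v] by [v (G + nu_j)] for one [j]
after the other, and follow the entry at [d] of [v P^n], of [v exp (t G)] or of
[v (u - G)^-1].  That entry of [v] itself is [0] until the last step, so each
replacement turns into a one-term recurrence, a first-order differential
equation or a multiplication by [u + nu_j], that is into one geometric or
exponential factor of the law of [T].  After the last step [v] is a multiple of
[pi], for which everything is explicit.  This gives the generating function
([probability_generating_function]), the Laplace transform
([laplace_transform]) and, for real eigenvalues, the laws themselves
([geometric_convolution], [law_convolution]). *)

(** * Spectral products of a skip-free matrix *)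

Definition supported_up_to (F : fieldType) (d : nat) (v : 'rV[F]_d.+1) (k : nat) :=
  forall m : 'I_d.+1, (k < m)%N -> v 0 m = 0.

Definition spectral_step (F : fieldType) (d : nat) (A : 'M[F]_d.+1)
    (v : 'rV[F]_d.+1) (z : F) : 'rV[F]_d.+1 := v *m (A + z%:M).

Lemma spectral_stepE (F : fieldType) (d : nat) (A : 'M[F]_d.+1) v z :
  spectral_step A v z = v *m A + z *: v.
Proof. by rewrite /spectral_step mulmxDr mul_mx_scalar. Qed.

Lemma foldl_spectral_step (F : fieldType) (d : nat) (A : 'M[F]_d.+1) s v :
  foldl (spectral_step A) v s = v *m \prod_(z <- s) (A + z%:M).
Proof.
elim: s v => [|z s IH] v /=; first by rewrite big_nil mulmx1.
by rewrite IH big_cons /spectral_step -mulmxA.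
Qed.

Lemma supported_delta (F : fieldType) (d : nat) :
  supported_up_to (delta_mx 0 0 : 'rV[F]_d.+1) 0.
Proof. by move=> m m0; rewrite mxE eqxx/=; case: m m0 => -[]. Qed.

Lemma big_codom (d : nat) (S C : Type) (op : C -> C -> C) (idx : C) (r : 'I_d -> S) F :
  \big[op/idx]_(z <- codom r) F z = \big[op/idx]_(j < d) F (r j).
Proof. by rewrite codomE big_map enumT [index_enum _]unlock. Qed.

Section SkipFreeAlgebra.
Variables (F : fieldType) (d : nat) (A : 'M[F]_d.+1).
Hypothesis skipA : forall i j : 'I_d.+1, (i.+1 < j)%N -> A i j = 0.

(** A skip-free matrix moves mass up by at most one state. *)
Lemma supported_step v k z : supported_up_to v k ->
  supported_up_to (spectral_step A v z) k.+1.
Proof.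
move=> vk m km; rewrite spectral_stepE !mxE vk 1?ltnW// mulr0 addr0.
apply: big1 => j _; have [jk|kj] := leqP j k; last by rewrite vk ?mul0r.
by rewrite skipA ?mulr0// (leq_ltn_trans _ km).
Qed.

(** The highest entry of the new vector can only come from an upward step. *)
Lemma top_entry_step v (i j : 'I_d.+1) z : j = i.+1 :> nat ->
  supported_up_to v i -> spectral_step A v z 0 j = v 0 i * A i j.
Proof.
move=> ji vi; rewrite spectral_stepE !mxE [v 0 j]vi ?ji// mulr0 addr0.
rewrite (bigD1 i)//= big1 ?addr0// => k ki.
have [|ik] := ltnP i k; first by move/vi->; rewrite mul0r.
rewrite skipA ?mulr0// ji ltnS ltn_neqAle ik andbT.
by apply: contra ki => /eqP ki; apply/eqP/val_inj.
Qed.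

Hypothesis upA : forall i j : 'I_d.+1, j = i.+1 :> nat -> A i j != 0.

(** Column [i.+1] of [v *m A = 0] expresses [v 0 i] through the entries of [v]
above [i], since [A i i.+1] is nonzero; so [v] is determined by its last entry,
and the left kernel of [A] is at most a line. *)
Lemma left_kernel_eq0 (v : 'rV[F]_d.+1) : v *m A = 0 -> v 0 ord_max = 0 -> v = 0.
Proof.
move=> vA vd.
suff H k (i : 'I_d.+1) : (d <= i + k)%N -> v 0 i = 0.
  by apply/rowP => i; rewrite mxE (H d)// leq_addl.
elim: k i => [|k IH] i.
  rewrite addn0 => di; rewrite -[RHS]vd; congr (v 0 _); apply: val_inj => /=.
  by apply/eqP; rewrite eqn_leq di -ltnS ltn_ord.
move=> dik; have [id|di] := ltnP i d; last by apply: IH; rewrite (leq_trans di)// leq_addr.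
have id' : (i.+1 < d.+1)%N by [].
pose j := Ordinal id'.
have /rowP/(_ j) := vA; rewrite !mxE (bigD1 i)//= big1 ?addr0; last first.
  move=> l li; have [il|il] := ltnP i l.
    by rewrite IH ?mul0r//; lia.
  rewrite skipA ?mulr0//= ltnS ltn_neqAle il andbT.
  by apply: contra li => /eqP li; apply/eqP/val_inj.
by move/eqP; rewrite mulf_eq0 (negbTE (@upA i j erefl)) orbF => /eqP.
Qed.

Lemma foldl_top_entry s v (i : 'I_d.+1) : (i + size s)%N = d ->
  supported_up_to v i -> v 0 i != 0 -> foldl (spectral_step A) v s 0 ord_max != 0.
Proof.
elim: s v i => [|z s IH] v i /=.
  rewrite addn0 => id _; suff -> : i = ord_max by []; exact: val_inj.
move=> ids vi vi0.
have id' : (i.+1 < d.+1)%N by move: ids; lia.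
apply: (IH _ (Ordinal id')) => /=; first by move: ids; lia.
  exact: supported_step.
by rewrite (top_entry_step (i := i))// mulf_neq0// upA.
Qed.

Variables (p : 'rV[F]_d.+1) (s : seq F).
Hypothesis pA : p *m A = 0.
Hypothesis p1 : \sum_i p 0 i = 1.
Hypothesis A1 : forall i, \sum_j A i j = 0.
Hypothesis sz : size s = d.
Hypothesis chi : char_poly (- A) = 'X * \prod_(z <- s) ('X - z%:P).

(** By Cayley-Hamilton the vector lies in the left kernel of [A], so it is a
multiple of [p]; the factor is found by summing the entries, because
[A + z%:M] multiplies the sum of the entries of a row vector by [z] when the row
sums of [A] vanish. *)
Lemma spectral_productE :
  foldl (spectral_step A) (delta_mx 0 0) s = (\prod_(z <- s) z) *: p.
Proof.
set v := foldl _ _ _.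
have vA : v *m A = 0.
  (* The factor 'X of the characteristic polynomial contributes the A on the
     right, and each factor 'X - z contributes A + z up to sign. *)
  rewrite /v foldl_spectral_step -mulmxA.
  have := Cayley_Hamilton (- A); rewrite chi mulrC rmorphM/= horner_mx_X rmorph_prod/=.
  have -> : \prod_(z <- s) horner_mx (- A) ('X - z%:P) =
      (-1) ^+ size s * \prod_(z <- s) (A + z%:M).
    elim: (s) => [|z t IH]; first by rewrite !big_nil mulr1.
    rewrite !big_cons /= IH rmorphB/= horner_mx_X horner_mx_C exprS.
    by rewrite -opprD !mulNr mul1r mulrA -!commr_sign -!mulrA commr_sign.
  rewrite mulrN => /eqP; rewrite oppr_eq0 -mulrA => /eqP H.
  have -> : \prod_(z <- s) (A + z%:M) *m A = 0.
    by have := congr1 (fun M => (-1) ^+ size s * M) H; rewrite signrMK mulr0.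
  by rewrite mulmx0.
have pd : p 0 ord_max != 0.
  apply/eqP => pd; have p0 := left_kernel_eq0 pA pd.
  have := oner_neq0 F; rewrite -p1 p0 big1 ?eqxx// => i _; by rewrite mxE.
have vp : v = (v 0 ord_max / p 0 ord_max) *: p.
  apply/eqP; rewrite -subr_eq0; apply/eqP/left_kernel_eq0.
    by rewrite mulmxBl vA -scalemxAl pA scaler0 subr0.
  by rewrite !mxE divfK// subrr.
have sumv t w : \sum_i foldl (spectral_step A) w t 0 i =
    (\sum_i w 0 i) * \prod_(z <- t) z.
  elim: t w => [|z t IH] w /=; first by rewrite big_nil mulr1.
  rewrite IH big_cons mulrA; congr (_ * _).
  transitivity (\sum_i (\sum_j w 0 j * A j i + z * w 0 i)).
    by apply: eq_bigr => i _; rewrite spectral_stepE !mxE.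
  rewrite big_split/= exchange_big/= big1 ?add0r.
    by rewrite -mulr_sumr mulrC.
  by move=> i _; rewrite -mulr_sumr A1 mulr0.
set c := v 0 ord_max / p 0 ord_max in vp.
suff -> : \prod_(z <- s) z = c by [].
have := sumv s (delta_mx 0 0); rewrite -/v.
have -> : \sum_i v 0 i = c.
  rewrite vp -[RHS]mulr1 -p1 mulr_sumr.
  by apply: eq_bigr => i _; rewrite mxE.
rewrite (bigD1 0)//= big1 ?mxE ?eqxx ?addr0 ?mul1r// => i i0.
by rewrite mxE eqxx/= (negbTE i0).
Qed.

(** This is the entry at [d] of the vector of [spectral_productE], which is also
the product of the entries [A i i.+1]. *)
Lemma prod_eigenvalues_neq0 : (\prod_(z <- s) z) * p 0 ord_max != 0.
Proof.
have <- : foldl (spectral_step A) (delta_mx 0 0) s 0 ord_max =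
    (\prod_(z <- s) z) * p 0 ord_max by rewrite spectral_productE mxE.
apply: (@foldl_top_entry _ _ ord0) => //; last by rewrite mxE eqxx oner_neq0.
by move=> m m0; rewrite mxE eqxx/=; case: m m0 => -[].
Qed.

End SkipFreeAlgebra.

(** * Generators and transition matrices *)

Section CharPoly.
Variable F : fieldType.

Lemma char_poly_sub (n : nat) (M : 'M[F]_n) (a : F) (s : seq F) : size s = n ->
  char_poly M = \prod_(z <- s) ('X - z%:P) ->
  char_poly (a%:M - M) = \prod_(z <- s) ('X - (a - z)%:P).
Proof.
move=> sn chi; pose h : {rmorphism {poly F} -> {poly F}} := comp_poly (a%:P - 'X).
have hX : h 'X = a%:P - 'X by exact: comp_polyX.
have hC c : h c%:P = c%:P by exact: comp_polyC.
have -> : char_poly (a%:M - M) = (-1) ^+ n * h (char_poly M).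
  rewrite /char_poly -det_map_mx -detZ; congr (\det _); apply/matrixP => i j.
  rewrite !mxE [h _]rmorphB/= -[comp_poly _ _]/(h _) -[X in _ = _ * (_ - X)]/(h _) hC.
  case: (i == j); rewrite ?mulr0n ?mulr1n ?rmorph0 ?hX ?polyCB ?polyC0; ring.
rewrite chi rmorph_prod -sn.
elim: (s) => [|z t IH]; first by rewrite !big_nil mulr1.
by rewrite !big_cons exprS -IH rmorphB hX hC polyCB; ring.
Qed.

End CharPoly.

Section Generators.
Variables (R : realType) (d : nat).
Implicit Types (G P : 'M[R]_d.+1) (pi : 'rV[R]_d.+1).

Lemma generator_transition P : is_transition_matrix P -> is_generator (P - 1%:M).
Proof.
move=> [P0 P1]; split=> [i j ij|i]; first by rewrite !mxE (negbTE ij) subr0.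
rewrite (eq_bigr (fun j => P i j - (i == j)%:R)); last by move=> j _; rewrite !mxE.
rewrite sumrB P1 (bigD1 i)//= eqxx big1 ?addr0 ?subrr// => j.
by rewrite eq_sym => /negbTE ->.
Qed.

Lemma irreducible_transition P : irreducible P -> irreducible (P - 1%:M).
Proof.
move=> irr x y; have := irr x y; apply: connect_sub => i j /= Pij.
have [->|ij] := eqVneq i j; first exact: connect0.
by apply: connect1; rewrite /= !mxE (negbTE ij) subr0.
Qed.

Lemma skip_free_transition P : skip_free P -> skip_free (P - 1%:M).
Proof.
move=> sk i j ij; rewrite !mxE sk// (_ : i == j = false) ?subrr//.
by apply/negbTE; apply: contraTneq ij => ->; rewrite -leqNgt leqnSn.
Qed.

Lemma stationary_transition P pi :
  stationary P pi -> stationary_generator (P - 1%:M) pi.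
Proof. by move=> [pid piP]; split; rewrite // mulmxBr piP mulmx1 subrr. Qed.

(** A path from [i] to [i.+1] has to leave [{0, ..., i}], and for a skip-free
matrix the only way out is the step from [i] to [i.+1]. *)
Lemma irreducible_up G (i j : 'I_d.+1) : irreducible G -> skip_free G ->
  j = i.+1 :> nat -> 0 < G i j.
Proof.
move=> irr sk ji; rewrite ltNge; apply/negP => Gij.
have [p pth jp] := connectP (irr i j).
suff H k q : path [rel i j | 0 < G i j] k q -> (k <= i)%N -> (last k q <= i)%N.
  by have := H _ _ pth (leqnn _); rewrite -jp ji ltnn.
elim: q k => [//|l q IH] k /= /andP[Gkl pthk] ki.
apply: IH pthk _; rewrite leqNgt; apply/negP => il.
have [kl|lk] := ltnP k.+1 l; first by rewrite sk ?ltxx in Gkl.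
have ki' : k = i by apply/val_inj; move: ki il lk => /=; lia.
have lj : l = j by apply/val_inj; rewrite /= ji; move: ki il lk => /=; lia.
by move: Gkl; rewrite ki' lj ltNge Gij.
Qed.

(** If [pi] vanished at a state [z] entered from [x] with [pi 0 x > 0], the
balance equation at [z] would have a positive inflow and no outflow; positivity
thus spreads along paths. *)
Lemma stationary_gt0 G pi : is_generator G -> irreducible G ->
  stationary_generator G pi -> forall x, 0 < pi 0 x.
Proof.
move=> [G0 _] irr [[pi0 pi1] piG] y.
have [x px] : exists x, 0 < pi 0 x.
  apply: contrapT => /forallNP H; have := oner_neq0 R; rewrite -pi1 big1 ?eqxx//.
  by move=> i _; apply/eqP; rewrite eq_le pi0 andbT leNgt; apply/negP/H.
have [p pth ->] := connectP (irr x y).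
elim: p x px pth => [//|z p IH] x px /= /andP[Gxz pth].
apply: IH pth; rewrite lt_neqAle pi0 andbT eq_sym; apply/eqP => pz.
have [xz|xz] := eqVneq x z; first by rewrite xz pz ltxx in px.
have /rowP/(_ z) := piG; rewrite !mxE (bigD1 x)//= => /eqP.
rewrite gt_eqF// ltr_wpDr ?mulr_gt0// sumr_ge0// => k _.
have [->|kz] := eqVneq k z; first by rewrite pz mul0r.
by rewrite mulr_ge0// G0.
Qed.

(** The identity is needed over the complex numbers, and over the reals when the
eigenvalues are real; the embedding [f] covers both cases. *)
Lemma generator_spectral_product G pi (F : fieldType) (f : {rmorphism R -> F})
    (s : seq F) :
  is_generator G -> irreducible G -> skip_free G -> stationary_generator G pi ->
  size s = d -> char_poly (map_mx f (- G)) = 'X * \prod_(z <- s) ('X - z%:P) ->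
  foldl (spectral_step (map_mx f G)) (delta_mx 0 0) s =
    (\prod_(z <- s) z) *: map_mx f pi /\
  (\prod_(z <- s) z) * f (pi 0 ord_max) != 0.
Proof.
move=> [G0 G1] irr sk [[pi0 pi1] piG] sz chi.
have sA (i j : 'I_d.+1) : (i.+1 < j)%N -> (map_mx f G) i j = 0.
  by move=> ij; rewrite mxE sk// rmorph0.
have uA (i j : 'I_d.+1) : j = i.+1 :> nat -> (map_mx f G) i j != 0.
  by move=> ij; rewrite mxE fmorph_eq0 gt_eqF// irreducible_up.
have pA : map_mx f pi *m map_mx f G = 0 by rewrite -map_mxM piG map_mx0.
have p1 : \sum_i (map_mx f pi) 0 i = 1.
  transitivity (f (\sum_i pi 0 i)); last by rewrite pi1 rmorph1.
  by rewrite rmorph_sum; apply: eq_bigr => i _; rewrite mxE.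
have A1 i : \sum_j (map_mx f G) i j = 0.
  transitivity (f (\sum_j G i j)); last by rewrite G1 rmorph0.
  by rewrite rmorph_sum; apply: eq_bigr => j _; rewrite mxE.
rewrite map_mxN in chi; split; first exact: spectral_productE.
have := prod_eigenvalues_neq0 sA uA pA p1 A1 sz chi.
by rewrite mxE.
Qed.

Lemma real_char_poly G (nu : 'I_d -> R[i]) (r : 'I_d -> R) :
  eigenvalues G (0 :: codom nu) -> (forall j, nu j = (r j)%:C) ->
  char_poly G = 'X * \prod_(z <- codom r) ('X - z%:P).
Proof.
rewrite /eigenvalues -map_char_poly => chi nur.
apply: (map_poly_inj (real_complex R)); rewrite chi big_cons subr0.
rewrite rmorphM/= map_polyX rmorph_prod; congr (_ * _).
rewrite !codomE !big_map; apply: eq_bigr => j _.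
by rewrite nur rmorphB/= map_polyX map_polyC.
Qed.

Lemma char_poly_transition P (theta : 'I_d -> R[i]) :
  eigenvalues P (1 :: codom theta) ->
  eigenvalues (- (P - 1%:M)) (0 :: codom (fun j => 1 - theta j)).
Proof.
rewrite /eigenvalues => chi.
have -> : map_mx (real_complex R) (- (P - 1%:M)) =
    1%:M - map_mx (real_complex R) P.
  by rewrite opprB map_mxB map_mx1.
rewrite (char_poly_sub _ _ chi)/= ?size_codom ?card_ord//.
rewrite !big_cons !subrr; congr (_ * _).
by rewrite !codomE !big_map.
Qed.

End Generators.

(** * Generating function and geometric convolution *)

Lemma spectral_step_transition (F : fieldType) (d : nat) (B : 'M[F]_d.+1)
    (v : 'rV[F]_d.+1) (z : F) (n : nat) :
  v *m B ^+ n.+1 =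
    spectral_step (B - 1%:M) v z *m B ^+ n + (1 - z) *: (v *m B ^+ n).
Proof.
rewrite exprS -mulmxE mulmxA spectral_stepE mulmxDl -scalemxAl mulmxBr mulmx1.
by rewrite mulmxBl scalerBl scale1r -addrA [_ *: _ + _]addrC !subrK.
Qed.

Lemma spectral_step_entry (F : fieldType) (d : nat) (B : 'M[F]_d.+1)
    (v : 'rV[F]_d.+1) (z : F) (n : nat) j :
  (v *m B ^+ n.+1) 0 j = (spectral_step (B - 1%:M) v z *m B ^+ n) 0 j
    + (1 - z) * (v *m B ^+ n) 0 j.
Proof.
by rewrite (spectral_step_transition _ _ z) mxE; congr (_ + _); rewrite mxE.
Qed.

Section GeneratingFunction.
Variables (F : numFieldType) (d : nat) (B : 'M[F]_d.+1) (p : 'rV[F]_d.+1).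
Hypothesis pB : p *m B = p.
Hypothesis skipB : forall i j : 'I_d.+1, (i.+1 < j)%N -> (B - 1%:M) i j = 0.

Lemma invariant_pow n : p *m B ^+ n = p.
Proof.
elim: n => [|n IH]; first by rewrite expr0 mulmx1.
by rewrite exprS -mulmxE mulmxA pB.
Qed.

Definition occupation_gf (u : F) (v : 'rV[F]_d.+1) (N : nat) : F :=
  \sum_(n < N) (v *m B ^+ n) 0 ord_max * u ^+ n.

(** [spectral_step_entry] gives a recurrence in [n] for the entry at [d] of
[v *m B ^+ n], which starts from [0]; summing it against [u ^+ n] leaves a
boundary term of order [u ^+ N]. *)
Lemma occupation_gf_step (u : F) (v : 'rV[F]_d.+1) (z : F) N : v 0 ord_max = 0 ->
  (1 - u * (1 - z)) * occupation_gf u v N =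
  u * occupation_gf u (spectral_step (B - 1%:M) v z) N
  - u ^+ N * (v *m B ^+ N) 0 ord_max.
Proof.
rewrite /occupation_gf => vd.
elim: N => [|N IH]; first by rewrite !big_ord0 expr0 mulmx1 vd !mulr0 subrr.
rewrite 2!big_ord_recr/= [LHS]mulrDr {}IH (spectral_step_entry _ _ z).
by rewrite exprS; ring.
Qed.

Hypothesis boundB : forall v : 'rV[F]_d.+1,
  exists C : F, forall n, `|(v *m B ^+ n) 0 ord_max| <= C.

(** Working with partial sums and a bounded remainder avoids any convergence
question for complex power series, and keeps the factors [1 - u * (1 - z)],
which are not yet known to be nonzero, on the left-hand side. *)
Lemma occupation_gf_expansion (u c : F) (s : seq F) (v : 'rV[F]_d.+1) k : (k + size s)%N = d ->
  supported_up_to v k ->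
  foldl (spectral_step (B - 1%:M)) v s = c *: p ->
  exists2 b : nat -> F, exists C : F, forall N, `|b N| <= C &
    forall N, (1 - u) * \prod_(z <- s) (1 - u * (1 - z)) * occupation_gf u v N =
      u ^+ size s * (c * p 0 ord_max) + u ^+ N * b N.
Proof.
elim: s v k => [|z s IH] v k /=.
  move=> _ _ ->; exists (fun=> - (c * p 0 ord_max)).
    by exists `|- (c * p 0 ord_max)|.
  move=> N; rewrite big_nil mulr1 /occupation_gf.
  rewrite (eq_bigr (fun n : 'I_N => c * p 0 ord_max * u ^+ n)); last first.
    by move=> n _; rewrite -scalemxAl invariant_pow mxE.
  rewrite -mulr_sumr mulrCA -opprB mulNr -subrX1; ring.
move=> ksz vk fold.
have vd : v 0 ord_max = 0 by apply: vk => /=; move: ksz; lia.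
have [||b [C bC] bE] := IH _ k.+1 _ _ fold; first by move: ksz; lia.
  exact: supported_step.
have [D vD] := boundB v.
pose e := (1 - u) * \prod_(z <- s) (1 - u * (1 - z)).
exists (fun N => u * b N - e * (v *m B ^+ N) 0 ord_max).
  exists (`|u| * C + `|e| * D) => N; rewrite (le_trans (ler_normB _ _))//.
  by rewrite lerD// normrM ler_wpM2l.
move=> N; rewrite big_cons.
have := bE N; have := occupation_gf_step u z N vd; rewrite -/e.
set S := occupation_gf u v N; set S' := occupation_gf u _ N => SE S'E.
transitivity (e * ((1 - u * (1 - z)) * S)); first by rewrite /e; ring.
transitivity (u * (e * S') - u ^+ N * (e * (v *m B ^+ N) 0 ord_max)).
  by rewrite SE; ring.
by rewrite S'E exprS; ring.
Qed.

End GeneratingFunction.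

Section Geometric.
Variables (R : realType) (d : nat) (B : 'M[R]_d.+1) (p : 'rV[R]_d.+1).
Hypothesis pB : p *m B = p.
Hypothesis skipB : forall i j : 'I_d.+1, (i.+1 < j)%N -> (B - 1%:M) i j = 0.

Lemma pmf_convolution_geometric0 (z : R) g : pmf_convolution (geometric_pmf z) g 0 = 0.
Proof. by rewrite /pmf_convolution big_ord_recl big_ord0 /= mul0r addr0. Qed.

Lemma pmf_convolution_geometricS (z : R) g n :
  pmf_convolution (geometric_pmf z) g n.+1 =
  z * g n + (1 - z) * pmf_convolution (geometric_pmf z) g n.
Proof.
rewrite /pmf_convolution big_ord_recl/= mul0r add0r.
rewrite big_ord_recl/= expr0 mulr1 subn1/=; congr (_ + _).
rewrite [in RHS]big_ord_recl/= mul0r add0r mulr_sumr; apply: eq_bigr => i _.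
rewrite /bump/= !add1n add0n !subSS exprS; ring.
Qed.

Lemma pmf_convolutionZr (a : R) (f g : nat -> R) n :
  pmf_convolution f (fun k => a * g k) n = a * pmf_convolution f g n.
Proof.
by rewrite /pmf_convolution mulr_sumr; apply: eq_bigr => i _; rewrite mulrCA.
Qed.

Definition first_difference (f : nat -> R) (n : nat) : R :=
  if n is m.+1 then f n - f m else f 0%N.

(** With [v'] the vector obtained from [v] by the step [z], the first differences
[g] and [g'] of the sequences attached to [v] and [v'] satisfy [g 0 = 0] and
[g (n + 1) = g' n + (1 - z) * g n], which is the recurrence of the convolution
of [g' / z] with the geometric law of parameter [z]. *)
Lemma spectral_pmf c s (v : 'rV[R]_d.+1) k : (k + size s)%N = d ->
  supported_up_to v k ->
  foldl (spectral_step (B - 1%:M)) v s = c *: p ->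
  forall n, (\prod_(z <- s) z) *
      first_difference (fun n => (v *m B ^+ n) 0 ord_max) n =
    c * p 0 ord_max *
      (\big[@pmf_convolution R/@pmf_dirac0 R]_(z <- s) geometric_pmf z) n.
Proof.
elim: s v k => [|z s IH] v k /=.
  move=> _ _ -> n; rewrite !big_nil mul1r.
  case: n => [|n] /=; rewrite -!scalemxAl !(invariant_pow pB) mxE /pmf_dirac0/=.
    by rewrite mulr1.
  by rewrite mulr0 subrr.
move=> ksz vk fold n.
have vd : v 0 ord_max = 0 by apply: vk => /=; move: ksz; lia.
have ksz' : (k.+1 + size s)%N = d by rewrite addSnnS.
have {}IH := IH _ k.+1 ksz' (supported_step skipB _ vk) fold.
set v' := spectral_step _ v z in fold IH.
have rec m : z * first_difference (fun n => (v *m B ^+ n) 0 ord_max) m =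
    pmf_convolution (geometric_pmf z)
      (first_difference (fun n => (v' *m B ^+ n) 0 ord_max)) m.
  elim: m => [|m IHm].
    by rewrite pmf_convolution_geometric0 /= expr0 mulmx1 vd mulr0.
  rewrite pmf_convolution_geometricS -IHm /=.
  have step j : (v *m B ^+ j.+1) 0 ord_max =
      (v' *m B ^+ j) 0 ord_max + (1 - z) * (v *m B ^+ j) 0 ord_max.
    exact: spectral_step_entry.
  rewrite step; case: m {IHm} => [|m] /=; last by rewrite !step; ring.
  by rewrite expr0 !mulmx1 vd; ring.
rewrite !big_cons.
transitivity (pmf_convolution (geometric_pmf z) (fun m => (\prod_(z <- s) z) *
    first_difference (fun n => (v' *m B ^+ n) 0 ord_max) m) n).
  by rewrite pmf_convolutionZr -rec; ring.
rewrite -pmf_convolutionZr; congr (pmf_convolution _ _ n).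
by apply/funext => m; exact: IH.
Qed.

End Geometric.

Section Bounded.
Variables (R : realType) (d : nat) (P : 'M[R]_d.+1).
Hypothesis trP : is_transition_matrix P.

Lemma transition_pow n : is_transition_matrix (P ^+ n).
Proof.
elim: n => [|n [IH0 IH1]].
  split=> [i j|i]; first by rewrite expr0 mxE ler0n.
  rewrite (bigD1 i)//= expr0 mxE eqxx big1 ?addr0// => j ji.
  by rewrite mxE eq_sym (negbTE ji).
have [P0 P1] := trP; rewrite exprS -mulmxE; split=> [i j|i].
  by rewrite mxE sumr_ge0// => k _; rewrite mulr_ge0.
rewrite (eq_bigr (fun j => \sum_k P i k * (P ^+ n) k j)); last first.
  by move=> j _; rewrite mxE.
rewrite exchange_big/= -[RHS](P1 i); apply: eq_bigr => k _.
by rewrite -mulr_sumr IH1 mulr1.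
Qed.

Lemma transition_le1 (Q : 'M[R]_d.+1) i j : is_transition_matrix Q -> Q i j <= 1.
Proof. by move=> [Q0 Q1]; rewrite -(Q1 i) (bigD1 j)//= lerDl sumr_ge0. Qed.

Lemma transition_pow_bounded (v : 'rV[R[i]]_d.+1) :
  exists C : R[i], forall n,
    `|(v *m (map_mx (real_complex R) P) ^+ n) 0 ord_max| <= C.
Proof.
exists (\sum_i `|v 0 i|) => n; rewrite -rmorphXn/= mxE.
rewrite (le_trans (ler_norm_sum _ _ _))// ler_sum// => i _.
have [Q0 Q1] := transition_pow n.
rewrite normrM ler_piMr// mxE ger0_norm.
  by rewrite lecR transition_le1.
by rewrite lecR.
Qed.

End Bounded.

(** * Adding an independent uniform variable *)

Lemma measure_partition (R : realType) (dO : measure_display)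
    (Om : measurableType dO) (mu : probability Om R) (n : nat)
    (Y : Om -> 'I_n) (A : set Om) :
  (forall x, measurable [set w | Y w = x]) -> measurable A ->
  mu A = (\sum_(x < n) mu (A `&` [set w | Y w = x]))%E.
Proof.
move=> mY mA; rewrite -measure_bigsetU_ord.
- congr (mu _); apply/seteqP; split=> w.
    by move=> Aw; rewrite -bigcup_seq/=; exists (Y w) => //=; rewrite mem_index_enum.
  by rewrite -bigcup_seq/= => -[x _ []].
- by move=> x; apply: measurableI.
- by move=> x y _ _ [w [[_ /= <-] [_ /= <-]]].
Qed.

Lemma sigma_algebra_finite_preimage (Om : Type) (F : set (set Om)) (n : nat)
    (Y : Om -> 'I_n) (D : set 'I_n) : sigma_algebra setT F ->
  (forall x, F [set w | Y w = x]) -> F (Y @^-1` D).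
Proof.
move=> [F0 _ FU] FY.
have -> : Y @^-1` D = \bigcup_k
    (if (insub k : option 'I_n) is Some x then
       if x \in D then [set w | Y w = x] else set0 else set0).
  apply/seteqP; split=> [w Dw|w [k _]].
    by exists (val (Y w)) => //; rewrite valK mem_set.
  case: insubP => [x _ _|//]; case: ifPn => [/set_mem Dx /= -> //|_] /=.
  by [].
apply: FU => k; case: insubP => // x _ _; by case: ifP.
Qed.

Section Enlargement.
Context {dI : Order.disp_t} {I : porderType dI} {R : realType}.
Context {dO : measure_display} {Om : measurableType dO} (mu : probability Om R).
Context {dU : measure_display} {U : measurableType dU} (lam : probability U R).

(** The first coordinate is known from the start: an event is known at time [i]
when, for every value of that coordinate, its section is in [F i]. Defining the
sigma-algebra by sections rather than by generators makes the Markov property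
a computation of integrals. *)
Definition enlarged (F : I -> set (set Om)) (i : I) : set (set (U * Om)) :=
  [set C | measurable C /\ forall u, F i (xsection C u)].

Lemma enlarged_filtration F : filtration F -> filtration (enlarged F).
Proof.
move=> [sF mF ndF]; split=> [i|i C []//|i j ij C [mC FC]].
  have [F0 FC FU] := sF i; split.
  - by split=> [//|u]; rewrite xsection0.
  - move=> C [mC Cu]; split=> [|u]; first exact: measurableD.
    rewrite xsectionD (_ : xsection setT u = setT); first exact: FC.
    by apply/seteqP; split=> // w _; apply/xsectionP.
  - move=> C FC'; split=> [|u]; first by apply: bigcupT_measurable => k; case: (FC' k).
    by rewrite xsection_bigcup; apply: FU => k; case: (FC' k).
by split=> // u; apply: ndF ij _ _.
Qed.

Lemma enlarged_cylinder F i (B : set Om) : filtration F -> F i B ->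
  enlarged F i (snd @^-1` B).
Proof.
move=> [_ mF _] FB; split=> [|u]; last by rewrite xsection_preimage_snd.
by rewrite -[X in measurable X]setTI; apply: measurable_snd => //; exact: mF FB.
Qed.

Lemma product_cylinder (B : set Om) : measurable B ->
  (lam \x mu)%E (snd @^-1` B) = mu B.
Proof.
move=> mB; have -> : snd @^-1` B = [set: U] `*` B by apply/seteqP; split=> -[u w] // [].
by rewrite product_measure1E// -[RHS]mul1e; congr (_ * _)%E; exact: probability_setT.
Qed.

(** The identity holds on every section, and is integrated over the first
coordinate. *)
Lemma enlarged_markov (A : set (U * Om)) (B C : set Om) (c : R) :
  measurable A -> measurable B -> measurable C ->
  (forall u, mu (xsection A u `&` B `&` C) = (mu (xsection A u `&` B) * c%:E)%E) ->
  (lam \x mu)%E (A `&` snd @^-1` B `&` snd @^-1` C) =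
  ((lam \x mu)%E (A `&` snd @^-1` B) * c%:E)%E.
Proof.
move=> mA mB mC H.
have mS (D : set Om) : measurable D -> measurable (snd @^-1` D : set (U * Om)).
  by move=> mD; rewrite -[X in measurable X]setTI; apply: measurable_snd.
rewrite /product_measure1.
under eq_integral => u _ do rewrite /= !xsectionI !xsection_preimage_snd H.
under [X in _ = (X * _)%E]eq_integral => u _ do
  rewrite /= xsectionI xsection_preimage_snd.
have mAB u : measurable (xsection A u `&` B).
  by apply: measurableI => //; exact: measurable_xsection.
have [c0|c0] := leP 0 c.
  rewrite ge0_integralZr//.
  have := measurable_fun_xsection mu (measurableI _ _ mA (mS _ mB)).
  apply: eq_measurable_fun => u _.
  by rewrite /= xsectionI xsection_preimage_snd.
(* A negative c can only multiply a null measure. *)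
have AB0 u : mu (xsection A u `&` B) = 0%E.
  apply/eqP; rewrite eq_le measure_ge0 andbT.
  have : (0 <= mu (xsection A u `&` B `&` C))%E by [].
  by rewrite H nmule_lge0.
by rewrite integral0_eq ?integral0_eq ?mul0e// => u _; rewrite AB0 ?mul0e.
Qed.

Lemma threshold_measurable n (Y : Om -> 'I_n) (f : 'I_n -> set U) :
  (forall x, measurable [set w | Y w = x]) -> (forall x, measurable (f x)) ->
  measurable [set uw : U * Om | f (Y uw.2) uw.1].
Proof.
move=> mY mf.
have -> : [set uw : U * Om | f (Y uw.2) uw.1] =
    \big[setU/set0]_(x < n) (f x `*` [set w | Y w = x]).
  rewrite -bigcup_seq; apply/seteqP; split=> [[u w] /= fu|[u w] /=].
    by exists (Y w) => //=; rewrite mem_index_enum.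
  by move=> [x _ [/= fu ->]].
by apply: bigsetU_measurable => x _; apply: measurableX.
Qed.

Lemma threshold_cylinder n (Y : Om -> 'I_n) (f : 'I_n -> set U) (x : 'I_n) :
  (forall x, measurable [set w | Y w = x]) -> (forall x, measurable (f x)) ->
  (lam \x mu)%E ([set uw : U * Om | f (Y uw.2) uw.1] `&`
                 snd @^-1` [set w | Y w = x]) =
  (lam (f x) * mu [set w | Y w = x])%E.
Proof.
move=> mY mf; rewrite -product_measure1E//; congr product_measure1.
by apply/seteqP; split=> [[u w] /= [fu <-]|[u w] /= [fu ->]].
Qed.

Lemma threshold_enlarged n (Y : Om -> 'I_n) (f : 'I_n -> set U) F i :
  filtration F -> (forall x, F i [set w | Y w = x]) -> (forall x, measurable (f x)) ->
  enlarged F i [set uw : U * Om | f (Y uw.2) uw.1].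
Proof.
move=> [sF mF _] FY mf; split.
  by apply: (@threshold_measurable n Y f) => // x; apply: (mF i); exact: FY.
move=> u; have -> : xsection [set uw : U * Om | f (Y uw.2) uw.1] u =
    Y @^-1` [set x | f x u].
  by apply/seteqP; split=> w; rewrite xsectionP.
exact: sigma_algebra_finite_preimage.
Qed.

End Enlargement.

Lemma uniform_threshold (R : realType) (q : R) : 0 <= q -> q <= 1 ->
  uniform_prob (@ltr01 R) `]-oo, q]%classic = q%:E.
Proof.
move=> q0 q1; rewrite /uniform_prob integral_uniform_pdf.
have -> : `]-oo, q]%classic `&` `[0, 1]%classic = `[0, q]%classic :> set R.
  apply/seteqP; split=> x /=; rewrite !in_itv/=; first by move=> [-> /andP[->]].
  by move=> /andP[-> xq]; rewrite xq (le_trans xq).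
rewrite (eq_integral (fun=> 1%E)); last first.
  move=> x /[!inE]/=; rewrite in_itv/= /uniform_pdf => /andP[x0 xq].
  by rewrite x0 (le_trans xq)// subr0 invr1.
rewrite integral_cst//= mul1e lebesgue_measure_itv/= lte_fin.
by case: ltP => [|q0']; rewrite ?oppr0 ?adde0// (le_anti (introT andP (conj q0' q0))).
Qed.

(** If [a * pi <= p] pointwise, where [p] is the law of [Y], an event of
probability [a], given which [Y] has the law [pi], can be produced from an
independent uniform variable [U]: it is [U <= a * pi Y / p Y]. *)
Lemma randomized_event (dI : Order.disp_t) (I : porderType dI) (R : realType)
    (dO : measure_display) (Om : measurableType dO) (mu : probability Om R)
    (F : I -> set (set Om)) (i : I) (n : nat) (Y : Om -> 'I_n)
    (p pi : 'I_n -> R) (a : R) :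
  filtration F -> (forall x, F i [set w | Y w = x]) ->
  (forall x, mu [set w | Y w = x] = (p x)%:E) ->
  0 <= a -> (forall x, 0 <= pi x) -> \sum_x pi x = 1 ->
  (forall x, a * pi x <= p x) ->
  exists C : set (measurableTypeR R * Om),
    [/\ enlarged F i C, (uniform_prob (@ltr01 R) \x mu)%E C = a%:E &
      forall x, (uniform_prob (@ltr01 R) \x mu)%E
        (C `&` snd @^-1` [set w | Y w = x]) = (a * pi x)%:E].
Proof.
move=> fF FY pY a0 pi0 pi1 api; have [_ mF _] := fF.
have mY x : measurable [set w | Y w = x] by exact: mF (FY x).
pose q x := a * pi x / p x.
have p0 x : 0 <= p x by rewrite -lee_fin -pY.
have qp x : q x * p x = a * pi x.
  (* A null p x forces a * pi x = 0. *)
  have [px0|px0] := eqVneq (p x) 0; last by rewrite /q divfK.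
  rewrite px0 mulr0; apply/eqP; rewrite eq_le mulr_ge0//=.
  by rewrite -px0 api.
have q0 x : 0 <= q x by rewrite divr_ge0// mulr_ge0.
have q1 x : q x <= 1.
  have [px0|px0] := eqVneq (p x) 0; first by rewrite /q px0 invr0 mulr0.
  by rewrite ler_pdivrMr ?mul1r// lt_neqAle eq_sym px0 p0.
pose lam : probability (measurableTypeR R) R := uniform_prob (@ltr01 R).
pose f x : set (measurableTypeR R) := [set` `]-oo, q x]].
have mf x : measurable (f x) by exact: measurable_itv.
pose C := [set uw : measurableTypeR R * Om | f (Y uw.2) uw.1].
have FC : enlarged F i C by exact: threshold_enlarged.
have CY x : (lam \x mu)%E (C `&` snd @^-1` [set w | Y w = x]) = (a * pi x)%:E.
  rewrite (threshold_cylinder mu lam)//=.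
  by rewrite [X in (X * _)%E]uniform_threshold// pY -EFinM qp.
have mYs x : measurable [set uw : measurableTypeR R * Om | Y uw.2 = x].
  by have [_ mF' _] := enlarged_filtration (U := measurableTypeR R) fF;
    exact: mF' (enlarged_cylinder (U := measurableTypeR R) fF (FY x)).
exists C; split=> //; case: FC => mC _.
pose mu' : probability (measurableTypeR R * Om)%type R := (lam \x mu)%E.
rewrite [LHS](measure_partition mu' mYs mC) (eq_bigr (fun x => (a * pi x)%:E)).
  by rewrite sumEFin -mulr_sumr pi1 mulr1.
by move=> x _; exact: CY.
Qed.

(** * The distribution function of a fastest strong stationary time *)

Lemma natural_filtration_sub (dI : Order.disp_t) (I : porderType dI)
    (D : set I) (dO : measure_display) (Om : measurableType dO) (S : Type)
    (X : I -> Om -> S) (F : I -> set (set Om)) : filtration F ->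
  (forall i x, D i -> F i [set w | X i w = x]) ->
  forall i, natural_filtration D X i `<=` F i.
Proof.
move=> [sF mF ndF] FX i; apply: smallest_sub => // A [j [x [Dj ji ->]]].
exact: ndF ji _ (FX j x Dj).
Qed.

Lemma natural_filtrationP (dI : Order.disp_t) (I : porderType dI)
    (D : set I) (dO : measure_display) (Om : measurableType dO) (S : Type)
    (X : I -> Om -> S) (F : I -> set (set Om)) : filtration F ->
  (forall i x, D i -> F i [set w | X i w = x]) ->
  filtration (natural_filtration D X).
Proof.
move=> fF FX; have [sF mF ndF] := fF; split=> [i|i|i j ij].
- exact: smallest_sigma_algebra.
- by move=> A /(natural_filtration_sub fF FX); exact: mF.
- apply: smallest_sub; first exact: smallest_sigma_algebra.
  move=> A [k [x [Dk ki ->]]]; apply: sub_sigma_algebra.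
  by exists k, x; split=> //; exact: le_trans ij.
Qed.

Lemma probability1_disjoint (dO : measure_display) (Om : measurableType dO)
    (R : realType) (mu : probability Om R) (A B : set Om) :
  measurable A -> measurable B -> mu A = 1%E -> A `&` B = set0 -> mu B = 0%E.
Proof.
move=> mA mB A1 AB0; apply/eqP; rewrite eq_le measure_ge0 andbT.
have -> : B = B `&` ~` A.
  by rewrite setIidl//; apply/disjoints_subset; rewrite setIC.
apply: (@le_trans _ _ (mu (~` A))); last first.
  by rewrite probability_setC// A1 subee.
by apply: measureIr => //; exact: measurableC.
Qed.

Section Discrete.
Variables (R : realType) (d : nat) (P : 'M[R]_d.+1).

Lemma dt_markov_natural (dO : measure_display) (Om : measurableType dO)
    (mu : probability Om R) F (X : nat -> Om -> 'I_d.+1) :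
  dt_markov P mu F X -> dt_markov P mu (natural_filtration [set: nat] X) X.
Proof.
move=> [fF FX mk]; have FX' i x : [set: nat] i -> F i [set w | X i w = x] by [].
split.
- exact: natural_filtrationP FX'.
- by move=> n x; apply: sub_sigma_algebra; exists n, x.
- by move=> n A x y /(natural_filtration_sub fF FX'); exact: mk.
Qed.

Lemma dt_law (dO : measure_display) (Om : measurableType dO)
    (mu : probability Om R) F (X : nat -> Om -> 'I_d.+1) :
  dt_markov P mu F X -> mu [set w | X 0%N w = ord0] = 1%E ->
  forall n y, mu [set w | X n w = y] = ((P ^+ n) 0 y)%:E.
Proof.
move=> [[sF mF ndF] FX mk] X0.
have mX n y : measurable [set w | X n w = y] by exact: mF (FX n y).
elim=> [|n IH] y.
  rewrite expr0 mxE; have [<-|y0] := eqVneq 0 y; first exact: X0.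
  apply: probability1_disjoint X0 _ => //.
  by apply/seteqP; split=> w //= [w0 wy]; case/eqP: y0; rewrite -wy w0.
rewrite (measure_partition mu (mX n))//.
have FT : F n setT by have [F0 FC _] := sF n; rewrite -(setD0 setT); exact: FC.
have step x : mu ([set w | X n.+1 w = y] `&` [set w | X n w = x]) =
    ((P ^+ n) 0 x * P x y)%:E.
  by rewrite setIC -[X in mu X]setTI setIA mk// setTI IH -EFinM.
under eq_bigr => x _ do rewrite step.
by rewrite sumEFin exprSr -mulmxE mxE.
Qed.

(** The competitor stops at [n0] on the event of [randomized_event], and never
stops otherwise. At [n0] it is stationary by construction; from there on the
Markov property and the stationarity of [pi] preserve this. *)
Lemma dt_competitor pi (dO : measure_display) (Om : measurableType dO)
    (mu : probability Om R) (X : nat -> Om -> 'I_d.+1) (T : Om -> option nat)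
    (n0 : nat) (a : R) :
  stationary P pi -> dt_chain_from0 P mu X -> dt_fastest_sst P pi mu X T ->
  0 <= a -> (forall x, a * pi 0 x <= (P ^+ n0) 0 x) ->
  (mu [set w | ~~ le_time (T w) n0] <= (1 - a)%:E)%E.
Proof.
move=> [[pi0 pi1] piP] [mkX X0] [_ fast] a0 api.
have pX := dt_law mkX X0; have [fF FX mk] := mkX.
set F := natural_filtration _ _ in fF FX mk.
have mX n y : measurable [set w | X n w = y].
  by have [_ mF _] := fF; exact: mF (FX n y).
have [C [FC C1 CX0]] := randomized_event fF (FX n0) (pX n0) a0 pi0 pi1 api.
pose lam : probability (measurableTypeR R) R := uniform_prob (@ltr01 R).
pose mu' : probability (measurableTypeR R * Om)%type R := (lam \x mu)%E.
pose X' n (uw : measurableTypeR R * Om) := X n uw.2.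
pose T' (uw : measurableTypeR R * Om) := if `[< C uw >] then Some n0 else None.
have TE n : [set uw | le_time (T' uw) n] = if (n0 <= n)%N then C else set0.
  apply/seteqP; split=> uw /=; rewrite /T'.
    by case: asboolP => //= Cuw n0n; rewrite n0n.
  by case: ifP => // n0n /asboolT ->.
have mkX' : dt_markov P mu' (enlarged F) X'.
  split; first exact: enlarged_filtration.
  - by move=> n x; exact: (enlarged_cylinder (U := measurableTypeR R) fF (FX n x)).
  - move=> n A x y [mA FA].
    exact: (enlarged_markov lam mA (mX n x) (mX n.+1 y)
      (fun u => mk n _ x y (FA u))).
have X'0 : mu' [set uw | X' 0%N uw = ord0] = 1%E.
  by rewrite [LHS](product_cylinder mu lam (mX 0%N ord0)).
have [[sF' mF' ndF'] FX' mk'] := mkX'.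
have mX' m z : measurable [set uw | X' m uw = z] by exact: mF' (FX' m z).
have mC : measurable C by case: FC.
have CXD m y : mu' (C `&` [set uw | X' (n0 + m)%N uw = y]) = (a * pi 0 y)%:E.
  elim: m y => [|m IH] y; first by rewrite addn0 [LHS]CX0.
  have FC' := ndF' _ _ (leq_addr m n0) _ FC.
  have step x : mu' (C `&` [set uw | X' (n0 + m.+1)%N uw = y] `&`
      [set uw | X' (n0 + m)%N uw = x]) = (a * pi 0 x * P x y)%:E.
    by rewrite setIAC addnS mk'// IH -EFinM.
  rewrite (measure_partition mu' (mX' (n0 + m)%N)); last exact: measurableI.
  under eq_bigr => x _ do rewrite step.
  rewrite sumEFin; congr EFin; rewrite -[in RHS]piP mxE mulr_sumr.
  by apply: eq_bigr => x _; rewrite mulrA.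
have CX y n : (n0 <= n)%N ->
    mu' (C `&` [set uw | X' n uw = y]) = (a * pi 0 y)%:E.
  by move=> n0n; have := CXD (n - n0)%N y; rewrite subnKC.
have := fast _ _ mu' X' T'.
move=> /(_ (conj (dt_markov_natural mkX') X'0)) /(_ _ n0).
have -> : [set uw | ~~ le_time (T' uw) n0] = ~` C.
  have := TE n0; rewrite leqnn => <-.
  by apply/seteqP; split=> uw /=; move/negP.
rewrite probability_setC// [X in (1 - X)%E]C1 -EFinB; apply.
exists (enlarged F); split=> // n.
  rewrite TE; case: ifP => [n0n|_]; last by case: (sF' n).
  exact: ndF' FC.
move=> y; rewrite TE; case: ifP => [n0n|_]; last by rewrite set0I !measure0 mul0e.
by rewrite [LHS]CX// [X in (X * _)%E]C1 EFinM.
Qed.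

(** When [y] minimizes the ratio, the upper bound comes from
[T <= n, X n = y] being contained in [X n = y], and the lower bound from the
competitor. *)
Lemma dt_fastest_law pi (dO : measure_display) (Om : measurableType dO)
    (mu : probability Om R) (X : nat -> Om -> 'I_d.+1) (T : Om -> option nat)
    (n : nat) (y : 'I_d.+1) :
  stationary P pi -> dt_chain_from0 P mu X -> dt_fastest_sst P pi mu X T ->
  0 < pi 0 y ->
  (forall x, (P ^+ n) 0 y / pi 0 y * pi 0 x <= (P ^+ n) 0 x) ->
  measurable [set w | le_time (T w) n] /\
  mu [set w | le_time (T w) n] = ((P ^+ n) 0 y / pi 0 y)%:E.
Proof.
move=> st chain fast piy H; have [[F [[[sF mF ndF] FX mk] FT TX]] _] := fast.
have [mkX X0] := chain; have pX := dt_law mkX X0.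
have mT : measurable [set w | le_time (T w) n] by exact: mF (FT n).
split=> //; apply/eqP; rewrite eq_le; apply/andP; split.
  rewrite -(@lee_pmul2r _ (pi 0 y)%:E)// -TX -EFinM divfK ?gt_eqF// -pX.
  apply: measureIr => //; exact: mF (FX n y).
have a0 : 0 <= (P ^+ n) 0 y / pi 0 y by rewrite divr_ge0 ?(ltW piy)// -lee_fin -pX.
have := dt_competitor st chain fast a0 H.
have -> : [set w | ~~ le_time (T w) n] = ~` [set w | le_time (T w) n].
  by apply/seteqP; split=> w /=; move/negP.
rewrite probability_setC// -(fineK (fin_num_measure mu _ mT)) -EFinB !lee_fin.
by rewrite lerD2l lerN2.
Qed.

End Discrete.

Section Continuous.
Variables (R : realType) (d : nat) (G : 'M[R]_d.+1).

Lemma ct_markov_natural (dO : measure_display) (Om : measurableType dO)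
    (mu : probability Om R) F (X : R -> Om -> 'I_d.+1) :
  ct_markov G mu F X ->
  ct_markov G mu (natural_filtration [set t : R | 0 <= t] X) X.
Proof.
move=> [fF FX mk]; have FX' i x : [set t : R | 0 <= t] i -> F i [set w | X i w = x].
  by move=> i0; exact: FX.
split.
- exact: natural_filtrationP FX'.
- by move=> t x t0; apply: sub_sigma_algebra; exists t, x.
- by move=> s t A x y s0 st /(natural_filtration_sub fF FX'); exact: mk.
Qed.

Lemma ct_law (dO : measure_display) (Om : measurableType dO)
    (mu : probability Om R) F (X : R -> Om -> 'I_d.+1) :
  ct_markov G mu F X -> mu [set w | X 0 w = ord0] = 1%E ->
  forall t y, 0 <= t -> mu [set w | X t w = y] = (expmx (t *: G) 0 y)%:E.
Proof.
move=> [[sF mF ndF] FX mk] X0 t y t0.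
have mX s z : 0 <= s -> measurable [set w | X s w = z] by move=> s0; exact: mF (FX s z s0).
have FT : F 0 setT by have [F0 FC _] := sF 0; rewrite -(setD0 setT); exact: FC.
have := mk 0 t setT ord0 y (lexx _) t0 FT.
rewrite setTI X0 mul1e subr0 => <-.
rewrite -[RHS]adde0 -(@probability1_disjoint _ _ _ mu [set w | X 0 w = ord0]
  ([set w | X t w = y] `\` [set w | X 0 w = ord0]))//.
- by rewrite addeC setIC; apply: measureDI; exact: mX.
- exact: mX.
- by apply: measurableD; exact: mX.
- by apply/seteqP; split=> w //= -[? [_ ?]].
Qed.

(** This is the construction of [dt_competitor]. The competitor takes only the
values [t0] and infinity, so that the chain is observed at the single time
[t0]. *)
Lemma ct_competitor pi (dO : measure_display) (Om : measurableType dO)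
    (mu : probability Om R) (X : R -> Om -> 'I_d.+1) (T : Om -> \bar R)
    (t0 : R) (a : R) :
  is_distribution pi ->
  (forall t y, 0 <= t -> \sum_x pi 0 x * expmx (t *: G) x y = pi 0 y) ->
  ct_chain_from0 G mu X -> ct_fastest_sst G pi mu X T -> 0 <= t0 ->
  0 <= a -> (forall x, a * pi 0 x <= expmx (t0 *: G) 0 x) ->
  (mu [set w | (t0%:E < T w)%E] <= (1 - a)%:E)%E.
Proof.
move=> [pi0 pi1] piG [mkX X0] [_ fast] t00 a0 api.
have pX := ct_law mkX X0; have [fF FX mk] := mkX.
set F := natural_filtration _ _ in fF FX mk.
have mX t y : 0 <= t -> measurable [set w | X t w = y].
  by move=> ht; have [_ mF _] := fF; exact: mF (FX t y ht).
have [C [FC C1 CX0]] := randomized_event fF (FX t0 ^~ t00) (pX t0 ^~ t00) a0 pi0 pi1 api.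
pose lam : probability (measurableTypeR R) R := uniform_prob (@ltr01 R).
pose mu' : probability (measurableTypeR R * Om)%type R := (lam \x mu)%E.
pose X' t (uw : measurableTypeR R * Om) := X t uw.2.
pose T' (uw : measurableTypeR R * Om) := (if `[< C uw >] then t0%:E else +oo)%E.
have TE t : [set uw | (T' uw <= t%:E)%E] = if t0 <= t then C else set0.
  apply/seteqP; split=> uw /=; rewrite /T'.
    by case: asboolP => //= Cuw; rewrite lee_fin => ->.
  by case: ifP => // t0t /asboolT ->; rewrite lee_fin.
have mkX' : ct_markov G mu' (enlarged F) X'.
  split; first exact: enlarged_filtration.
  - by move=> t x ht; exact: (enlarged_cylinder (U := measurableTypeR R) fF (FX t x ht)).
  - move=> s t A x y s0 st [mA FA].
    exact: (enlarged_markov lam mA (mX s x s0) (mX t y (le_trans s0 st))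
      (fun u => mk s t _ x y s0 st (FA u))).
have X'0 : mu' [set uw | X' 0 uw = ord0] = 1%E.
  by rewrite [LHS](product_cylinder mu lam (mX 0 ord0 (lexx _))).
have [[sF' mF' ndF'] FX' mk'] := mkX'.
have mX' t z : 0 <= t -> measurable [set uw | X' t uw = z].
  by move=> ht; exact: mF' (FX' t z ht).
have mC : measurable C by case: FC.
have CX y t : t0 <= t -> mu' (C `&` [set uw | X' t uw = y]) = (a * pi 0 y)%:E.
  move=> t0t; have ht := le_trans t00 t0t.
  have step x : mu' (C `&` [set uw | X' t uw = y] `&` [set uw | X' t0 uw = x]) =
      (a * (pi 0 x * expmx ((t - t0) *: G) x y))%:E.
    by rewrite setIAC mk'// [X in (X * _)%E]CX0 -EFinM mulrA.
  rewrite (measure_partition mu' (fun x => mX' t0 x t00)); last first.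
    by apply: measurableI => //; exact: mX'.
  under eq_bigr => x _ do rewrite step.
  by rewrite sumEFin -mulr_sumr piG// subr_ge0.
have := fast _ _ mu' X' T'.
move=> /(_ (conj (ct_markov_natural mkX') X'0)) /(_ _ t0 t00).
have -> : [set uw | (t0%:E < T' uw)%E] = ~` C.
  have := TE t0; rewrite lexx => <-.
  by apply/seteqP; split=> uw /=; rewrite ltNge; move/negP.
rewrite probability_setC// [X in (1 - X)%E]C1 -EFinB; apply.
exists (enlarged F); split=> //.
- by move=> uw; rewrite /T'; case: ifP => // _; rewrite ?lee_fin// leey.
- move=> t ht; rewrite TE; case: ifP => [t0t|_]; last by case: (sF' t).
  exact: ndF' FC.
- move=> t y ht; rewrite TE; case: ifP => [t0t|_]; last by rewrite set0I !measure0 mul0e.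
  by rewrite [LHS]CX// [X in (X * _)%E]C1 EFinM.
Qed.

Lemma ct_fastest_law pi (dO : measure_display) (Om : measurableType dO)
    (mu : probability Om R) (X : R -> Om -> 'I_d.+1) (T : Om -> \bar R)
    (t : R) (y : 'I_d.+1) :
  is_distribution pi ->
  (forall t y, 0 <= t -> \sum_x pi 0 x * expmx (t *: G) x y = pi 0 y) ->
  ct_chain_from0 G mu X -> ct_fastest_sst G pi mu X T -> 0 <= t ->
  0 < pi 0 y ->
  (forall x, expmx (t *: G) 0 y / pi 0 y * pi 0 x <= expmx (t *: G) 0 x) ->
  measurable [set w | (T w <= t%:E)%E] /\
  mu [set w | (T w <= t%:E)%E] = (expmx (t *: G) 0 y / pi 0 y)%:E.
Proof.
move=> dpi piG chain fast t0 piy H.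
have [[F [[[sF mF ndF] FX mk] _ FT TX]] _] := fast.
have [mkX X0] := chain; have pX := ct_law mkX X0.
have mT : measurable [set w | (T w <= t%:E)%E] by exact: mF (FT t t0).
split=> //; apply/eqP; rewrite eq_le; apply/andP; split.
  rewrite -(@lee_pmul2r _ (pi 0 y)%:E)// -TX// -EFinM divfK ?gt_eqF// -pX//.
  apply: measureIr => //; exact: mF (FX t y t0).
have a0 : 0 <= expmx (t *: G) 0 y / pi 0 y.
  by rewrite divr_ge0 ?(ltW piy)// -lee_fin -pX.
have := ct_competitor dpi piG chain fast t0 a0 H.
have -> : [set w | (t%:E < T w)%E] = ~` [set w | (T w <= t%:E)%E].
  by apply/seteqP; split=> w /=; rewrite ltNge; move/negP.
rewrite probability_setC// -(fineK (fin_num_measure mu _ mT)) -EFinB !lee_fin.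
by rewrite lerD2l lerN2.
Qed.

End Continuous.

(** * Monotone reversals *)

Section MonotoneKernels.
Variables (R : realType) (d : nat).
Implicit Types (K : 'M[R]_d.+1) (f g : 'I_d.+1 -> R).

(** Summation by parts: [f] is a combination of indicators of the sets
[y <= z], with nonnegative weights, up to a constant. *)
Lemma tail_sum_le f g : (forall z : 'I_d.+1, 0 <= \sum_(y < d.+1 | (z <= y)%N) g y) ->
  (forall x y : 'I_d.+1, (x <= y)%N -> f y <= f x) ->
  \sum_y g y * f y <= f 0 * \sum_y g y.
Proof.
move=> g0 f_dec.
suff H j (k : 'I_d.+1) : (d <= k + j)%N ->
    \sum_(y < d.+1 | (k <= y)%N) g y * f y <= f k * \sum_(y < d.+1 | (k <= y)%N) g y.
  exact: (H d ord0).
elim: j k => [|j IH] k dkj.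
  have kd (y : 'I_d.+1) : ((k <= y)%N) = (y == k).
    apply/idP/eqP => [ky|->//]; apply/val_inj => /=.
    by move: (ltn_ord y) (ltn_ord k) ky dkj; lia.
  by rewrite !(eq_bigl _ _ kd) !big_pred1_eq mulrC.
have [kd|kd] := ltnP k d; last by apply: IH; move: kd; lia.
have kd' : (k.+1 < d.+1)%N by [].
pose l := Ordinal kd'.
have kl (y : 'I_d.+1) : ((k <= y)%N && (y != k)) = ((l <= y)%N).
  by rewrite /= [RHS]ltn_neqAle andbC eq_sym.
rewrite (bigD1 k)//= [X in _ <= _ * X](bigD1 k)//= !(eq_bigl _ _ kl).
rewrite mulrDr mulrC lerD2l (le_trans (IH l _))//.
  by move: dkj => /=; lia.
by rewrite ler_wpM2r// f_dec/=.
Qed.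

Lemma monotone_kernel_antitone K f (c : R) :
  stochastically_monotone K -> (forall x, \sum_y K x y = c) ->
  (forall x y : 'I_d.+1, (x <= y)%N -> f y <= f x) ->
  forall x x' : 'I_d.+1, (x <= x')%N ->
    \sum_y K x' y * f y <= \sum_y K x y * f y.
Proof.
move=> mK Kc f_dec x x' xx'; rewrite -subr_le0 -sumrB.
rewrite (eq_bigr (fun y => (K x' y - K x y) * f y)); last first.
  by move=> y _; rewrite mulrBl.
rewrite (le_trans (tail_sum_le _ f_dec))//.
  by move=> z; rewrite sumrB subr_ge0 mK.
by rewrite sumrB !Kc subrr mulr0.
Qed.

Lemma reversal_row_sum (P : 'M[R]_d.+1) (pi : 'rV[R]_d.+1) :
  pi *m P = pi -> (forall x, 0 < pi 0 x) ->
  forall x, \sum_y time_reversal pi P x y = 1.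
Proof.
move=> piP pi0 x; rewrite (eq_bigr (fun y => pi 0 y * P y x / pi 0 x)); last first.
  by move=> y _; rewrite mxE.
have /rowP/(_ x) := piP; rewrite -mulr_suml mxE => ->.
by rewrite divff// gt_eqF.
Qed.

(** The ratios at time [n.+1] are the image under the reversed kernel of the
ratios at time [n], and those at time [0] are a multiple of the indicator
of [0]. *)
Lemma transition_ratio_antitone (P : 'M[R]_d.+1) (pi : 'rV[R]_d.+1) :
  pi *m P = pi -> (forall x, 0 < pi 0 x) ->
  stochastically_monotone (time_reversal pi P) ->
  forall n (x y : 'I_d.+1), (x <= y)%N ->
    (P ^+ n) 0 y / pi 0 y <= (P ^+ n) 0 x / pi 0 x.
Proof.
move=> piP pi0 mK; elim=> [|n IH] x y xy.
  rewrite expr0 !mxE; have [y0|y0] := eqVneq 0 y; last first.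
    by rewrite mul0r divr_ge0 ?ler0n ?ltW.
  have -> : x = y; last by rewrite y0 eqxx.
  by apply/val_inj => /=; move: xy; rewrite -y0 leqn0 => /eqP.
have step z : (P ^+ n.+1) 0 z / pi 0 z =
    \sum_y time_reversal pi P z y * ((P ^+ n) 0 y / pi 0 y).
  rewrite exprSr -mulmxE mxE mulr_suml; apply: eq_bigr => w _.
  by rewrite mxE; field; rewrite !gt_eqF.
rewrite !step; apply: monotone_kernel_antitone IH x y xy => //.
exact: reversal_row_sum.
Qed.

End MonotoneKernels.

(** * The matrix exponential *)

Section MatrixExponential.
Variables (R : realType) (d : nat).
Implicit Types (A G : 'M[R]_d.+1).

Definition matrix_mass A : R := \sum_i \sum_j `|A i j|.

Lemma matrix_mass_ge0 A : 0 <= matrix_mass A.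
Proof. by rewrite sumr_ge0// => i _; rewrite sumr_ge0. Qed.

Lemma matrix_power_bound A k i j : `|(A ^+ k) i j| <= matrix_mass A ^+ k.
Proof.
elim: k i j => [|k IH] i j; first by rewrite !expr0 mxE normr_nat lern1 leq_b1.
rewrite !exprS -mulmxE mxE (le_trans (ler_norm_sum _ _ _))//.
apply: (@le_trans _ _ (\sum_l `|A i l| * matrix_mass A ^+ k)).
  by apply: ler_sum => l _; rewrite normrM ler_wpM2l.
rewrite -mulr_suml ler_wpM2r ?exprn_ge0 ?matrix_mass_ge0//.
rewrite /matrix_mass [leRHS](bigD1 i)//= lerDl sumr_ge0// => l _.
by rewrite sumr_ge0.
Qed.

Lemma cvg_dominated_exp (u : R^nat) (C M : R) : 0 <= C -> 0 <= M ->
  (forall k, `|u k| <= C * (M ^+ k / k`!%:R)) -> cvgn (series u).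
Proof.
move=> C0 M0 uCM; apply: normed_cvg.
apply: (@series_le_cvg _ _ (C *: exp_coeff M)) => //.
- by move=> k /=.
- by move=> k; apply: mulr_ge0 => //; apply: divr_ge0 => //; exact: exprn_ge0.
- exact/is_cvg_seriesZ/is_cvg_series_exp_coeff.
Qed.

Lemma cvgn_sum (I : Type) (r : seq I) (u : I -> R^nat) (l : I -> R) :
  (forall i, u i @ \oo --> l i) ->
  (fun n => \sum_(i <- r) u i n) @ \oo --> \sum_(i <- r) l i.
Proof.
move=> ul; elim: r => [|i r IH].
  rewrite big_nil (_ : (fun n => _) = fun=> 0); first exact: cvg_cst.
  by apply/funext => n; rewrite big_nil.
rewrite big_cons (_ : (fun n => _) = u i + fun n => \sum_(i <- r) u i n).
  exact: cvgD.
by apply/funext => n; rewrite big_cons.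
Qed.

Lemma expmx_cvg A i j :
  series (fun k : nat => (A ^+ k) i j / k`!%:R) @ \oo --> expmx A i j.
Proof.
rewrite mxE; apply: (@cvg_dominated_exp _ 1 (matrix_mass A)) => //.
  exact: matrix_mass_ge0.
move=> k; rewrite mul1r normrM [X in _ * X]ger0_norm ?invr_ge0//.
by rewrite ler_wpM2r ?invr_ge0// matrix_power_bound.
Qed.

(** The series that defines the exponential may be exchanged with a finite linear
combination of entries. *)
Lemma expmx_linear (I : finType) A (c : I -> R) (r s : I -> 'I_d.+1) (u : R^nat) :
  (forall k, u k = \sum_l c l * ((A ^+ k) (r l) (s l) / k`!%:R)) ->
  limn (series u) = \sum_l c l * expmx A (r l) (s l).
Proof.
move=> uE; apply/cvg_lim => //.
have -> : series u = fun n =>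
    \sum_l c l * series (fun k : nat => (A ^+ k) (r l) (s l) / k`!%:R) n.
  apply/funext => n; rewrite /series/=.
  under [RHS]eq_bigr => l _ do rewrite mulr_sumr.
  by rewrite exchange_big/=; apply: eq_bigr => k _; exact: uE.
apply: cvgn_sum => l; apply: cvgMl_tmp; exact: expmx_cvg.
Qed.

(** The coefficients, as a power series in [t], of the entries of the [m]-th
derivative of [exp (t G)]. *)
Definition exp_coeffs G i j m (k : nat) : R := (G ^+ (k + m)) i j / k`!%:R.

Lemma pseries_diffs_exp_coeffs G i j m :
  pseries_diffs (exp_coeffs G i j m) = exp_coeffs G i j m.+1.
Proof.
apply/funext => k; rewrite /pseries_diffs /exp_coeffs factS natrM addSnnS.
by field; rewrite ?pnatr_eq0 -?lt0n ?fact_gt0 //=.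
Qed.

Lemma cvg_exp_coeffs G i j m t : cvgn (pseries (exp_coeffs G i j m) t).
Proof.
apply: (@cvg_dominated_exp _ (matrix_mass G ^+ m) (matrix_mass G * `|t|)).
- by rewrite exprn_ge0// matrix_mass_ge0.
- by rewrite mulr_ge0// matrix_mass_ge0.
move=> k; rewrite /exp_coeffs !normrM normrX exprMn -mulrA mulrCA.
rewrite [`|_^-1|]ger0_norm ?invr_ge0//.
rewrite mulrA mulrCA [X in _ <= X](_ : _ =
  matrix_mass G ^+ (k + m) * (k`!%:R^-1 * `|t| ^+ k)); last by rewrite exprD; ring.
rewrite [leLHS](_ : _ = `|(G ^+ (k + m)) i j| * (k`!%:R^-1 * `|t| ^+ k)).
  rewrite ler_wpM2r ?matrix_power_bound// mulr_ge0 ?exprn_ge0//.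
by ring.
Qed.

Lemma expmxE G i j t : expmx (t *: G) i j = limn (pseries (exp_coeffs G i j 0%N) t).
Proof.
rewrite mxE; congr (limn (series _)); apply/funext => k.
by rewrite exprZn mxE /exp_coeffs/= addn0 mulrAC mulrC mulrA mulrAC.
Qed.

Lemma is_derive_expmx_pseries G i j (t : R) :
  is_derive t 1 (fun t => expmx (t *: G) i j)
    (limn (pseries (exp_coeffs G i j 1%N) t)).
Proof.
have -> : (fun t => expmx (t *: G) i j) =
    fun t => limn (pseries (exp_coeffs G i j 0%N) t).
  by apply/funext => x; exact: expmxE.
rewrite -pseries_diffs_exp_coeffs.
apply: (@pseries_snd_diffs _ _ (`|t| + 1)); rewrite ?pseries_diffs_exp_coeffs;
  try exact: cvg_exp_coeffs.
by rewrite [ltRHS]ger0_norm ?ltrDl// addr_ge0.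
Qed.

Lemma is_derive_expmxl G i j (t : R) :
  is_derive t 1 (fun t => expmx (t *: G) i j) (\sum_l G i l * expmx (t *: G) l j).
Proof.
have := is_derive_expmx_pseries G i j t.
congr (is_derive _ _ _ _); apply: expmx_linear => k.
rewrite /exp_coeffs/= addn1 exprS -mulmxE mxE 2!mulr_suml; apply: eq_bigr => l _.
by rewrite exprZn mxE; ring.
Qed.

Lemma is_derive_expmxr G i j (t : R) :
  is_derive t 1 (fun t => expmx (t *: G) i j) (\sum_l G l j * expmx (t *: G) i l).
Proof.
have := is_derive_expmx_pseries G i j t.
congr (is_derive _ _ _ _); apply: expmx_linear => k.
rewrite /exp_coeffs/= addn1 exprSr -mulmxE mxE 2!mulr_suml; apply: eq_bigr => l _.
by rewrite exprZn mxE; ring.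
Qed.

Lemma expmx0 i j : expmx (0 : 'M[R]_d.+1) i j = (i == j)%:R.
Proof.
rewrite mxE; apply/cvg_lim => //; apply: cvg_near_cst; exists 1%N => // n /= n0.
rewrite /series/= big_ltn// big_nat big1 ?addr0.
  by rewrite expr0 mxE invr1 mulr1.
by move=> k /andP[k0 _]; rewrite expr0n; case: k k0 => //= k _; rewrite mxE mul0r.
Qed.

Lemma invariant_expmx G (pi : 'rV[R]_d.+1) : pi *m G = 0 ->
  forall t y, \sum_x pi 0 x * expmx (t *: G) x y = pi 0 y.
Proof.
move=> piG t y; rewrite -[LHS](@expmx_linear _ _ (pi 0) id (fun=> y)
  (fun k => (k == 0)%:R * pi 0 y)).
  apply/cvg_lim => //; apply: cvg_near_cst; exists 1%N => // n /= n0.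
  rewrite /series/= big_ltn// big_nat big1 ?addr0 ?eqxx ?mul1r//.
  by move=> k /andP[k0 _]; case: k k0 => // k _; rewrite mul0r.
move=> k; rewrite (eq_bigr (fun x => (pi 0 x * ((t *: G) ^+ k) x y) / k`!%:R)).
  rewrite -mulr_suml; case: k => [|k].
    rewrite expr0 fact0 invr1 mulr1 mul1r (bigD1 y)//= mxE eqxx mulr1 big1 ?addr0//.
    by move=> x xy; rewrite mxE (negbTE xy) mulr0.
  have : pi *m (t *: G) ^+ k.+1 = 0.
    by rewrite exprS -mulmxE mulmxA -scalemxAr piG scaler0 mul0mx.
  by move=> /rowP/(_ y); rewrite !mxE => ->; rewrite !mul0r.
by move=> x _; rewrite mulrA.
Qed.

Lemma time_reversal_expmx G (pi : 'rV[R]_d.+1) : (forall x, 0 < pi 0 x) ->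
  forall t x y, expmx (t *: time_reversal pi G) x y =
    pi 0 y * expmx (t *: G) y x / pi 0 x.
Proof.
move=> pi0 t x y; rewrite mxE.
rewrite (@expmx_linear unit (t *: G) (fun=> pi 0 y / pi 0 x) (fun=> y) (fun=> x)).
  by rewrite big_const card_unit/= addr0 mulrAC.
have pw k : forall x y, (time_reversal pi G ^+ k) x y =
    pi 0 y * (G ^+ k) y x / pi 0 x.
  elim: k => [|k IH] a b.
    rewrite !expr0 !mxE eq_sym; have [->|] := eqVneq b a; last by rewrite !mulr0 mul0r.
    by rewrite mulr1 divff// gt_eqF.
  rewrite exprS -mulmxE mxE exprSr -mulmxE mxE mulr_sumr mulr_suml.
  apply: eq_bigr => c _; rewrite mxE IH; field.
  by rewrite !gt_eqF.
move=> k; rewrite big_const card_unit/= addr0 !exprZn !mxE pw; ring.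
Qed.

(** Monotonicity of the reversed semigroup is applied to the indicator of [0]. *)
Lemma generator_ratio_min G (pi : 'rV[R]_d.+1) : pi *m G = 0 ->
  (forall x, 0 < pi 0 x) ->
  stochastically_monotone_generator (time_reversal pi G) ->
  forall t x, 0 <= t ->
  expmx (t *: G) 0 ord_max / pi 0 ord_max <= expmx (t *: G) 0 x / pi 0 x.
Proof.
move=> piG pi0 mG t x t0; pose K := expmx (t *: time_reversal pi G).
have K1 z : \sum_y K z y = 1.
  rewrite (eq_bigr (fun y => pi 0 y * expmx (t *: G) y z / pi 0 z)).
    by rewrite -mulr_suml (invariant_expmx piG) divff// gt_eqF.
  by move=> y _; rewrite /K time_reversal_expmx.
have := @monotone_kernel_antitone _ _ K (fun y => (y == 0)%:R) 1 (mG t t0) K1 _ x ord_max.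
have K0 z : \sum_y K z y * (y == 0)%:R = pi 0 0 * (expmx (t *: G) 0 z / pi 0 z).
  rewrite (bigD1 0)//= big1 ?addr0; last by move=> y /negbTE ->; rewrite mulr0.
  by rewrite mulr1 /K time_reversal_expmx// mulrA.
rewrite !K0 (ler_pM2l (pi0 0)); apply; last by rewrite /= -ltnS.
move=> a b ab; case: (eqVneq b 0) => [b0|_]; last by rewrite ler0n.
suff -> : a = 0 by rewrite eqxx.
by apply/val_inj => /=; move: ab; rewrite b0 leqn0 => /eqP.
Qed.

End MatrixExponential.

(** * Complex bounds and functions of a discrete random time *)

Section ComplexBounds.
Variable R : realType.
Implicit Types (z u : R[i]).

Lemma normC_real z : `|z| = (complex.Re `|z|)%:C.
Proof. by rewrite normc_def. Qed.

Lemma Re_norm_ge0 z : 0 <= complex.Re `|z|.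
Proof. by rewrite -lecR -normC_real; exact: normr_ge0. Qed.

Lemma normr_Re_le z : `|complex.Re z| <= complex.Re `|z|.
Proof. by rewrite -lecR -normC_real normc_ge_Re. Qed.

Lemma normr_Im_le z : `|complex.Im z| <= complex.Re `|z|.
Proof.
rewrite -normrN -[X in complex.Re X]mul1r.
have -> : 1 = `|'i%C| :> R[i] by rewrite normc_def/= expr0n add0r expr1n sqrtr1.
rewrite -normrM; apply: le_trans (normr_Re_le _).
by case: z => a b /=; rewrite !mul0r mul1r add0r.
Qed.

Lemma normC_le_ReIm z : `|z| <= (`|complex.Re z| + `|complex.Im z|)%:C.
Proof.
rewrite [in leLHS](complexE z) (le_trans (ler_normD _ _))//.
rewrite rmorphD/= lerD// ?normrM.
  by rewrite normc_def/= expr0n addr0 sqrtr_sqr.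
by rewrite !normc_def/= !expr0n add0r expr1n sqrtr1 mul1r addr0 sqrtr_sqr.
Qed.

Lemma ReX_norm u k : complex.Re `|u ^+ k| = complex.Re `|u| ^+ k.
Proof. by rewrite normrX normC_real -rmorphXn. Qed.

Lemma eq0_geometric_bound z u (C : R[i]) : `|u| < 1 ->
  (forall N, `|z| <= C * `|u| ^+ N) -> z = 0.
Proof.
move=> u1 H; apply/eqP; rewrite -normr_le0 normC_real lecR.
set a := complex.Re `|z|; pose r := complex.Re `|u|.
have C0 : 0 <= C by have := H 0%N; rewrite mulr1; exact: le_trans.
pose c := complex.Re `|C|.
have Hr N : a <= c * r ^+ N.
  have := H N; rewrite -[C](ger0_norm C0) [`|z|]normC_real [`|C|]normC_real.
  by rewrite [`|u|]normC_real -rmorphXn -rmorphM lecR.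
have r1 : `|r| < 1.
  by rewrite ger0_norm ?Re_norm_ge0// -ltcR -normC_real.
have cr : c * r ^+ N @[N --> \oo] --> c * 0 by apply: cvgMl_tmp; exact: cvg_expr.
rewrite mulr0 in cr; rewrite -(cvg_lim _ cr)//.
apply: limr_ge; first by apply/cvg_ex; exists 0.
by apply: nearW => N; exact: Hr.
Qed.

End ComplexBounds.

Section TimeIntegral.
Context (R : realType) (dO : measure_display) (Om : measurableType dO)
  (mu : probability Om R) (T : Om -> option nat).
Hypothesis mT : forall k, measurable [set w | T w = Some k].

Lemma measurable_time_function (phi : option nat -> R) :
  measurable_fun setT (fun w => phi (T w)).
Proof.
move=> _ Y mY; rewrite setTI.
have -> : (fun w => phi (T w)) @^-1` Y =
    (\bigcup_(k in [set k | Y (phi (Some k))]) [set w | T w = Some k]) `|`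
    (if `[< Y (phi None) >] then ~` (\bigcup_k [set w | T w = Some k]) else set0).
  apply/seteqP; split=> w /=.
    case Tw: (T w) => [k|] Yw; first by left; exists k.
    by right; rewrite asboolT//= => -[k _ /=]; rewrite Tw.
  case=> [[k /= Yk Tk]|]; first by rewrite Tk.
  case: asboolP => // YN /= H; case Tw: (T w) => [k|//].
  by exfalso; apply: H; exists k.
apply: measurableU; first by apply: bigcup_measurable => k _.
case: ifP => // _; apply/measurableC/bigcup_measurable => k _; exact: mT.
Qed.

Lemma time_function_integrable (phi : option nat -> R) :
  (forall o, `|phi o| <= 1) -> mu.-integrable setT (EFin \o (fun w => phi (T w))).
Proof.
move=> phi1; apply: measurable_bounded_integrable => //.
- by rewrite -ge0_fin_numE//; exact: fin_num_measure.
- exact: measurable_time_function.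
- exists 1; split; first exact: num_real.
  by move=> x x1 w _ /=; rewrite (le_trans (phi1 _))// ltW.
Qed.

(** On [T >= N] the function is at most [r ^+ N] in absolute value, and on [T < N]
it takes finitely many values. *)
Lemma time_function_expansion (phi : option nat -> R) (r : R) (g : nat -> R) :
  0 <= r -> r <= 1 -> phi None = 0 -> (forall k, `|phi (Some k)| <= r ^+ k) ->
  (forall k, mu [set w | T w = Some k] = (g k)%:E) ->
  forall N, `|Rintegral mu setT (fun w => phi (T w)) -
     \sum_(k < N) g k * phi (Some (k : nat))| <= r ^+ N.
Proof.
move=> r0 r1 phiN phik gk N.
have phi1 o : `|phi o| <= 1.
  case: o => [k|]; last by rewrite phiN normr0.
  by rewrite (le_trans (phik k))// exprn_ile1.
pose I (M : nat) := Rintegral mu setT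
  (fun w => (fun o => if o is Some k then if (k < M)%N then phi o else 0 else 0) (T w)).
have bound M : forall o, `|(fun o => if o is Some k then
    if (k < M)%N then phi o else 0 else 0) o| <= (1 : R).
  by case=> [k|]; rewrite ?normr0//; case: ifP; rewrite ?normr0.
have IE M : I M = \sum_(k < M) g k * phi (Some (k : nat)).
  elim: M => [|M IH].
    rewrite big_ord0 /I (@eq_Rintegral _ _ _ _ _ (fun=> 0)).
      by rewrite Rintegral_cst// mul0r.
    by move=> w _; case: (T w).
  rewrite big_ord_recr/= -IH /I.
  pose psi (o : option nat) : R := if o is Some k then (k == M)%:R else 0.
  have psi1 o : `|psi o| <= 1.
    by case: o => [k|]; rewrite ?normr0//= normr_nat lern1 leq_b1.
  have -> : g M * phi (Some M) = Rintegral mu setT (fun w => psi (T w) * phi (Some M)).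
    rewrite RintegralZr//; last exact: time_function_integrable.
    congr (_ * _); rewrite -[LHS]/(fine (g M)%:E) -gk.
    rewrite -[in LHS](setIT [set w | T w = Some M]) -integral_indic//.
    congr fine; apply: eq_integral => w _; rewrite indicE; congr EFin.
    rewrite /psi; case Tw : (T w) => [k|]; last by rewrite memNset//= Tw.
    have [kM|kM] := eqVneq k M; first by rewrite mem_set//= Tw kM.
    by rewrite memNset//= Tw => -[/eqP]; rewrite (negbTE kM).
  rewrite -RintegralD//=.
  - apply: eq_Rintegral => w _; rewrite /psi; case: (T w) => [k|]; last by rewrite mul0r addr0.
    rewrite ltnS leq_eqVlt; have [kM|_] /= := eqVneq k M.
      by rewrite kM ltnn add0r mul1r.
    by rewrite mul0r addr0.
  - exact: time_function_integrable (bound M).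
  - apply: (time_function_integrable (phi := fun o => psi o * phi (Some M))) => o.
    by rewrite normrM mulr_ile1.
rewrite -IE /I -RintegralB//; last 2 first.
- exact: time_function_integrable.
- exact: time_function_integrable (bound N).
pose rest (o : option nat) := phi o - if o is Some k then
  if (k < N)%N then phi o else 0 else 0.
have restN o : `|rest o| <= r ^+ N.
  rewrite /rest; case: o => [k|]; last by rewrite phiN subrr normr0 exprn_ge0.
  case: ltnP => kN; first by rewrite subrr normr0 exprn_ge0.
  by rewrite subr0 (le_trans (phik k))// ler_wiXn2l.
have rest1 o : `|rest o| <= 1 by rewrite (le_trans (restN o))// exprn_ile1.
apply: le_trans (le_normr_Rintegral _ (time_function_integrable rest1)) _ => //.
apply: le_trans (le_Rintegral _ _ _ (fun w _ => restN (T w))) _ => //.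
- by apply: (time_function_integrable (phi := fun o => `|rest o|)) => o; rewrite normr_id.
- apply: (time_function_integrable (phi := fun=> r ^+ N)) => o.
  by rewrite ger0_norm ?exprn_ge0// exprn_ile1.
- by rewrite Rintegral_cst// [X in fine X](probability_setT mu) mulr1.
Qed.

End TimeIntegral.

(** * The discrete-time law *)

Section DiscreteConclusion.
Variables (R : realType) (d : nat) (P : 'M[R]_d.+1) (pi : 'rV[R]_d.+1).
Hypothesis trP : is_transition_matrix P.
Hypothesis irrP : irreducible P.
Hypothesis skP : skip_free P.
Hypothesis stP : stationary P pi.
Hypothesis monP : stochastically_monotone (time_reversal pi P).
Context (dO : measure_display) (Om : measurableType dO)
  (mu : probability Om R) (X : nat -> Om -> 'I_d.+1) (T : Om -> option nat).
Hypothesis chainX : dt_chain_from0 P mu X.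
Hypothesis fastT : dt_fastest_sst P pi mu X T.

Let pi_gt0 x : 0 < pi 0 x.
Proof.
apply: (@stationary_gt0 _ _ (P - 1%:M)).
- exact: generator_transition.
- exact: irreducible_transition.
- exact: stationary_transition.
Qed.

Definition sst_cdf (n : nat) : R := (P ^+ n) 0 ord_max / pi 0 ord_max.

Lemma dt_cdf n : measurable [set w | le_time (T w) n] /\
  mu [set w | le_time (T w) n] = (sst_cdf n)%:E.
Proof.
apply: (dt_fastest_law stP chainX fastT (pi_gt0 _)) => x.
rewrite -ler_pdivlMr//; have [_ piP] := stP.
by apply: (transition_ratio_antitone piP pi_gt0 monP); rewrite -ltnS.
Qed.

Lemma dt_pmf k : measurable [set w | T w = Some k] /\
  mu [set w | T w = Some k] = (first_difference sst_cdf k)%:E.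
Proof.
case: k => [|k].
  rewrite (_ : [set w | T w = Some 0%N] = [set w | le_time (T w) 0]); first exact: dt_cdf.
  apply/seteqP; split=> w /=; first by move=> ->.
  by case: (T w) => [k|//] /=; rewrite leqn0 => /eqP ->.
have [mk muk] := dt_cdf k; have [mk1 muk1] := dt_cdf k.+1.
have -> : [set w | T w = Some k.+1] =
    [set w | le_time (T w) k.+1] `\` [set w | le_time (T w) k].
  apply/seteqP; split=> w /=; first by move=> -> /=; rewrite ltnn.
  case: (T w) => [j|[]//] /= [jk /negP]; rewrite -ltnNge => kj.
  by congr Some; apply/eqP; rewrite eqn_leq jk kj.
split; first exact: measurableD.
transitivity (mu [set w | le_time (T w) k.+1] - mu [set w | le_time (T w) k])%E.
  rewrite measureD//; last by rewrite -ge0_fin_numE// fin_num_measure.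
  rewrite setIidr// => w /=.
  by case: (T w) => [j|//] /= jk; exact: leqW.
by rewrite muk muk1 EFinB.
Qed.

Let piP : pi *m P = pi. Proof. by case: stP. Qed.

Lemma sst_cdf_numerator n :
  ((delta_mx 0 0 : 'rV[R]_d.+1) *m P ^+ n) 0 ord_max = pi 0 ord_max * sst_cdf n.
Proof. by rewrite -rowE mxE /sst_cdf mulrC divfK ?gt_eqF. Qed.

Lemma geometric_convolution (q : 'I_d -> R) (theta : 'I_d -> R[i]) :
  eigenvalues P (1 :: codom theta) -> (forall j, theta j = (q j)%:C) ->
  forall k, mu [set w | T w = Some k] =
    ((\big[@pmf_convolution R/@pmf_dirac0 R]_(j < d) geometric_pmf (1 - q j)) k)%:E.
Proof.
move=> /char_poly_transition chi thq k; rewrite (dt_pmf k).2; congr EFin.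
pose r j := 1 - q j.
have /(real_char_poly chi) {}chi : forall j, 1 - theta j = (r j)%:C.
  by move=> j; rewrite thq rmorphB.
have [fold c0] := generator_spectral_product (f := idfun) (s := codom r)
  (generator_transition trP) (irreducible_transition irrP)
  (skip_free_transition skP) (stationary_transition stP)
  (etrans (size_codom r) (card_ord d)) (etrans (congr1 _ (map_mx_id (fun=> erefl) _)) chi).
rewrite !map_mx_id// in fold.
have sz : (0 + size (codom r))%N = d by rewrite size_codom card_ord.
have := spectral_pmf piP (skip_free_transition skP) sz (@supported_delta _ _) fold k.
have -> : first_difference (fun n => ((delta_mx 0 0 : 'rV[R]_d.+1) *m P ^+ n) 0 ord_max) k =
    pi 0 ord_max * first_difference sst_cdf k.
  by case: k => [|k]; rewrite /first_difference !sst_cdf_numerator ?mulrBr.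
by rewrite mulrA => /(mulfI c0) ->; rewrite big_codom.
Qed.

(** Up to an error of order [u ^+ N], the partial sums of the generating function
of [T] agree with [pgf mu T u] on one side, and with the product on the other by
[occupation_gf_expansion]. *)
Lemma probability_generating_function (theta : 'I_d -> R[i]) :
  eigenvalues P (1 :: codom theta) -> forall u : R[i], `|u| < 1 ->
  pgf mu T u = \prod_(j < d) ((1 - theta j) * u / (1 - theta j * u)).
Proof.
move=> /char_poly_transition chi u u1.
pose r j := 1 - theta j; pose PC := map_mx (real_complex R) P.
have PCE : map_mx (real_complex R) (P - 1%:M) = PC - 1%:M.
  by rewrite map_mxB map_mx1.
have chi' : char_poly (map_mx (real_complex R) (- (P - 1%:M))) =
    'X * \prod_(z <- codom r) ('X - z%:P) by rewrite chi big_cons subr0.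
have [fold c0] := generator_spectral_product
  (generator_transition trP) (irreducible_transition irrP)
  (skip_free_transition skP) (stationary_transition stP)
  (etrans (size_codom r) (card_ord d)) chi'.
rewrite PCE in fold.
have skC (i j : 'I_d.+1) : (i.+1 < j)%N -> (PC - 1%:M) i j = 0.
  by move=> ij; rewrite -PCE mxE skip_free_transition// rmorph0.
have piPC : map_mx (real_complex R) pi *m PC = map_mx (real_complex R) pi.
  by rewrite -map_mxM piP.
have sz : (0 + size (codom r))%N = d by rewrite size_codom card_ord.
have [b [B bB] bE] := occupation_gf_expansion piPC skC
  (transition_pow_bounded trP) u sz (@supported_delta _ _) fold.
set c := \prod_(z <- codom r) z in fold c0 bE.
set D := \prod_(z <- codom r) (1 - u * (1 - z)) in bE.
pose S N := \sum_(k < N) (first_difference sst_cdf k)%:C * u ^+ k.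
pose pd := (pi 0 ord_max)%:C.
have pd0 : pd != 0 by rewrite /pd eq_complex/= eqxx andbT gt_eqF.
(* Summation by parts, passing from the distribution function to the masses. *)
have occS N : pd * S N.+1 = (1 - u) * occupation_gf PC u (delta_mx 0 0) N.+1 +
    u ^+ N.+1 * (pd * (sst_cdf N)%:C).
  have aE n : ((delta_mx 0 0 : 'rV[R[i]]_d.+1) *m PC ^+ n) 0 ord_max =
      pd * (sst_cdf n)%:C.
    rewrite /PC -rmorphXn -rowE !mxE -rmorphM; congr (_%:C).
    by rewrite /sst_cdf mulrC divfK ?gt_eqF.
  rewrite /S /occupation_gf; elim: N => [|N IH].
    by rewrite !big_ord_recr !big_ord0/= aE; ring.
  by rewrite big_ord_recr mulrDr IH [in RHS]big_ord_recr/= aE !exprS rmorphB/=; ring.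
have pgfS M : `|pgf mu T u - S M| <= 2%:R * `|u| ^+ M.
  have r0 := Re_norm_ge0 u; set ru := complex.Re `|u| in r0.
  have r1 : ru <= 1 by rewrite -lecR -normC_real ltW.
  pose h (o : option nat) : R[i] := if o is Some k then u ^+ k else 0.
  have ReS : complex.Re (S M) =
      \sum_(k < M) first_difference sst_cdf k * complex.Re (h (Some (k : nat))).
    rewrite /S (big_morph (@complex.Re R) (id1 := 0) (op1 := +%R))//; last by case=> ? ? [].
    by apply: eq_bigr => k _ /=; case: (u ^+ k) => x y /=; rewrite mul0r subr0.
  have ImS : complex.Im (S M) =
      \sum_(k < M) first_difference sst_cdf k * complex.Im (h (Some (k : nat))).
    rewrite /S (big_morph (@complex.Im R) (id1 := 0) (op1 := +%R))//; last by case=> ? ? [].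
    by apply: eq_bigr => k _ /=; case: (u ^+ k) => x y /=; rewrite mul0r addr0.
  have mT k := (dt_pmf k).1; have pT k := (dt_pmf k).2.
  have := time_function_expansion mT (phi := @complex.Re R \o h) r0 r1 erefl _ pT M.
  have := time_function_expansion mT (phi := @complex.Im R \o h) r0 r1 erefl _ pT M.
  rewrite -ReS -ImS => HIm HRe.
  apply: le_trans (normC_le_ReIm _) _.
  rewrite [`|u|]normC_real -rmorphXn -(rmorph_nat (real_complex R)) -rmorphM lecR.
  rewrite mulr2n mulrDl mul1r lerD//.
    case: (S M) HRe {HIm ReS ImS} => x y /= HRe.
    by apply: HRe => k; rewrite -ReX_norm; exact: normr_Re_le.
  case: (S M) HIm {HRe ReS ImS} => x y /= HIm.
  by apply: HIm => k; rewrite -ReX_norm; exact: normr_Im_le.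
have cdf_norm N : `|(sst_cdf N)%:C| <= 1.
  have [mN muN] := dt_cdf N.
  rewrite ger0_norm ?lecR -?lee_fin -?muN//; exact: probability_le1.
have Z0 : pd * (D * pgf mu T u - u ^+ d * c) = 0.
  apply: (eq0_geometric_bound
    (C := (`|pd * D| * 2%:R + (B + `|D * pd|)) * `|u|) u1) => N.
  have -> : pd * (D * pgf mu T u - u ^+ d * c) =
      pd * D * (pgf mu T u - S N.+1) + u ^+ N.+1 * (b N.+1 + D * pd * (sst_cdf N)%:C).
    transitivity (pd * D * (pgf mu T u - S N.+1) +
      (D * (pd * S N.+1) - u ^+ d * (c * pd))); first by ring.
    congr (_ + _); rewrite occS mulrDr mulrA [D * _]mulrC bE.
    by rewrite size_codom card_ord mxE -/pd; ring.
  rewrite -[leRHS]mulrA -exprS mulrDl (le_trans (ler_normD _ _))// lerD//.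
    by rewrite normrM -mulrA ler_wpM2l.
  rewrite normrM normrX mulrC ler_wpM2r ?exprn_ge0//.
  rewrite (le_trans (ler_normD _ _))// lerD// normrM ler_piMr//.
have {Z0} DE : D * pgf mu T u = u ^+ d * c.
  by apply/eqP; rewrite -subr_eq0; have /eqP := Z0; rewrite mulf_eq0 (negbTE pd0).
have c0' : c != 0 by apply: contraNneq c0 => ->; rewrite mul0r.
(* If D vanished, u would vanish by DE, and then D would be 1. *)
have D0 : D != 0.
  apply/eqP => D0; have /eqP := DE; rewrite D0 mul0r eq_sym mulf_eq0 expf_eq0.
  rewrite (negbTE c0') orbF => /andP[_ /eqP u0].
  have /eqP := D0; rewrite /D u0 big1 ?oner_eq0// => z _.
  by rewrite mul0r subr0.
apply: (mulfI D0); rewrite DE prodf_div big_split/= prodr_const card_ord.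
have -> : \prod_(j < d) (1 - theta j) = c by rewrite /c big_codom.
have -> : \prod_(j < d) (1 - theta j * u) = D.
  rewrite /D big_codom; apply: eq_bigr => j _.
  by rewrite /r subKr mulrC.
by field.
Qed.

End DiscreteConclusion.

(** * Derivatives and integrals of exponentials *)

Section Calculus.
Variable R : realType.
Implicit Types (f F : R -> R).

Lemma is_derive_sum_scale (I : Type) (r : seq I) (c : I -> R) (f : I -> R -> R)
    (df : I -> R) (t : R) : (forall i, is_derive t 1 (f i) (df i)) ->
  is_derive t 1 (fun t => \sum_(i <- r) c i * f i t) (\sum_(i <- r) c i * df i).
Proof.
move=> fdf; elim: r => [|i r IH].
  rewrite big_nil (_ : (fun t => _) = cst 0); first exact: is_derive_cst.
  by apply/funext => x; rewrite big_nil.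
rewrite big_cons (_ : (fun t => _) = (c i *: f i) + (fun t => \sum_(i <- r) c i * f i t)).
  by apply: is_deriveD.
by apply/funext => x; rewrite big_cons.
Qed.

Lemma is_derive_continuous F df (t : R) : is_derive t 1 F df -> {for t, continuous F}.
Proof.
by move=> dF; apply/differentiable_continuous/derivable1_diffP; exact: ex_derive.
Qed.

Lemma integral_derivative_ray f F a l : (forall x, a <= x -> 0 <= f x) ->
  continuous f -> (forall x : R, is_derive x 1 F (f x)) ->
  F x @[x --> +oo] --> l ->
  (\int[lebesgue_measure]_(x in `[a, +oo[) (f x)%:E = (l - F a)%:E)%E.
Proof.
move=> f0 cf dF Fl; rewrite (ge0_continuous_FTC2y f0 _ Fl) -?EFinB//.
- exact: continuous_subspaceT.
- by apply: cvg_at_right_filter; exact: is_derive_continuous.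
- by move=> x _; rewrite derive1E; exact: derive_val.
Qed.

Lemma integral_derivative_segment f F a b : a <= b ->
  continuous f -> (forall x : R, is_derive x 1 F (f x)) ->
  (\int[lebesgue_measure]_(x in `[a, b]) (f x)%:E = (F b - F a)%:E)%E.
Proof.
rewrite le_eqVlt => /orP[/eqP <- _ _|ab cf dF].
  by rewrite set_itv1 integral_set1 subrr.
rewrite (continuous_FTC2 (F := F))// -?EFinB//.
- exact: continuous_subspaceT.
- split; first by move=> x _; exact: ex_derive.
  + by apply: cvg_at_right_filter; exact: is_derive_continuous.
  + by apply: cvg_at_left_filter; exact: is_derive_continuous.
- by move=> x _; rewrite derive1E; exact: derive_val.
Qed.

Lemma is_derive_expR_scale (c t : R) :
  is_derive t 1 (fun t => expR (c * t)) (c * expR (c * t)).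
Proof.
have lin : is_derive t 1 ( *%R c) c.
  by rewrite -[X in is_derive _ _ _ X]mulr1; exact: (@is_deriveZ _ _ _ id).
by have := @is_derive1_comp R expR ( *%R c) t _ _ (is_derive_expR (c * t)) lin; rewrite mulrC.
Qed.

Lemma expR_decay (c : R) : 0 < c -> expR (- c * t) @[t --> +oo] --> 0.
Proof.
move=> c0; rewrite (_ : (fun t => expR (- c * t)) =
    (fun z => expR (- z)) \o (fun z => c * z)); last first.
  by apply: eq_fun => x; rewrite mulNr.
apply: (@cvg_comp _ _ _ _ _ _ (pinfty_nbhs R)); last exact: cvgr_expR.
exact: gt0_cvgMry.
Qed.

End Calculus.

(** * The Laplace transform *)

Section ResolventAlgebra.
Variables (F : fieldType) (d : nat) (A : 'M[F]_d.+1) (p : 'rV[F]_d.+1) (u : F).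
Hypothesis pA : p *m A = 0.
Hypothesis skipA : forall i j : 'I_d.+1, (i.+1 < j)%N -> A i j = 0.
Hypothesis uA : u%:M - A \in unitmx.
Hypothesis u0 : u != 0.

(** Since [A + z = (u + z) - (u - A)], a spectral step applied to [v] changes
[v (u - A)^-1] into [(u + z) v (u - A)^-1 - v], and the entry at [d] of [v] is
[0] as long as a step remains. *)
Lemma resolvent_spectral c s (v : 'rV[F]_d.+1) k : (k + size s)%N = d ->
  supported_up_to v k -> foldl (spectral_step A) v s = c *: p ->
  u * \prod_(z <- s) (u + z) * (v *m invmx (u%:M - A)) 0 ord_max =
    c * p 0 ord_max.
Proof.
elim: s v k => [|z s IH] v k /=.
  move=> _ _ ->; rewrite big_nil mulr1 -scalemxAl.
  have -> : p *m invmx (u%:M - A) = u^-1 *: p.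
    rewrite -[RHS]mulmx1 -(mulmxV uA) mulmxA; congr (_ *m _).
    by rewrite mulmxBr -!scalemxAl pA scaler0 subr0 mul_mx_scalar scalerA mulVf// scale1r.
  by rewrite !mxE; field.
move=> ksz vk fold.
have ksz' : (k.+1 + size s)%N = d by rewrite addSnnS.
have := IH _ k.+1 ksz' (supported_step skipA _ vk) fold.
have vd : v 0 ord_max = 0 by apply: vk => /=; move: ksz; lia.
have -> : spectral_step A v z *m invmx (u%:M - A) =
    (u + z) *: (v *m invmx (u%:M - A)) - v.
  rewrite /spectral_step (_ : A + z%:M = (u + z)%:M - (u%:M - A)); last first.
    by rewrite raddfD/= opprB [RHS]addrC addrA subrK.
  by rewrite mulmxBr mulmxBl mul_mx_scalar -scalemxAl -[X in _ - X]mulmxA mulmxV// mulmx1.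
rewrite big_cons !mxE vd subr0 => <-; ring.
Qed.

End ResolventAlgebra.

(** Maximum principle: if [G v = u v] and [v] is largest in absolute value at [x],
the row of [x] in this equation gives [u * `|v x| <= 0]. *)
Lemma generator_resolvent_unit (R : realType) (d : nat) (G : 'M[R]_d.+1) (u : R) :
  is_generator G -> 0 < u -> u%:M - G \in unitmx.
Proof.
move=> [G0 G1] u0; rewrite unitmxE unitfE -det_tr; apply/negP => /det0P[v v0 vG].
have Gv x : u * v 0 x = \sum_y G x y * v 0 y.
  have /rowP/(_ x) := vG; rewrite !mxE => /eqP.
  rewrite (eq_bigr (fun y => u * (v 0 y * (x == y)%:R) - G x y * v 0 y)); last first.
    move=> y _; rewrite !mxE mulrBr mulr_natr; congr (_ - _); last by rewrite mulrC.
    by case: eqP => _; rewrite ?mulr1n ?mulr0n ?mulr0// mulrC.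
  rewrite sumrB subr_eq0 => /eqP <-; rewrite -mulr_sumr (bigD1 x)//= eqxx mulr1.
  by rewrite big1 ?addr0// => y; rewrite eq_sym => /negbTE ->; rewrite mulr0.
have [x xmax] : exists x, forall y, `|v 0 y| <= `|v 0 x|.
  pose x := [arg max_(x > ord0) `|v 0 x|]%O.
  by exists x => y; rewrite /x; case: arg_maxP => // z _; exact.
have : u * `|v 0 x| <= 0.
  have := Gv x; rewrite (bigD1 x)//= [_ + _]addrC => /eqP; rewrite -subr_eq -mulrBl => /eqP H.
  have Gxx : G x x = - \sum_(y | y != x) G x y.
    by have /eqP := G1 x; rewrite (bigD1 x)//= addr_eq0 => /eqP.
  have Gs : 0 <= \sum_(y | y != x) G x y.
    by apply: sumr_ge0 => y yx; rewrite G0// eq_sym.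
  have : `|(u - G x x) * v 0 x| <= (\sum_(y | y != x) G x y) * `|v 0 x|.
    rewrite H (le_trans (ler_norm_sum _ _ _))// mulr_suml ler_sum// => y yx.
    by rewrite normrM ger0_norm ?G0 1?eq_sym// ler_wpM2l// G0// eq_sym.
  rewrite normrM ger0_norm; last by rewrite Gxx opprK addr_ge0// ltW.
  by rewrite Gxx opprK mulrDl gerDr.
rewrite pmulr_rle0// normr_le0 => /eqP vx; case/negP: v0; apply/eqP/rowP => y.
by rewrite mxE; apply/eqP; rewrite -normr_le0 (le_trans (xmax y))// vx normr0.
Qed.

Section ContinuousConclusion.
Variables (R : realType) (d : nat) (G : 'M[R]_d.+1) (pi : 'rV[R]_d.+1).
Hypothesis genG : is_generator G.
Hypothesis irrG : irreducible G.
Hypothesis skG : skip_free G.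
Hypothesis stG : stationary_generator G pi.
Hypothesis monG : stochastically_monotone_generator (time_reversal pi G).
Context (dO : measure_display) (Om : measurableType dO)
  (mu : probability Om R) (X : R -> Om -> 'I_d.+1) (T : Om -> \bar R).
Hypothesis chainX : ct_chain_from0 G mu X.
Hypothesis fastT : ct_fastest_sst G pi mu X T.

Let pi_gt0 x : 0 < pi 0 x. Proof. exact: stationary_gt0 genG irrG stG x. Qed.

Let piG : pi *m G = 0. Proof. by case: stG. Qed.

Definition sst_ct_cdf (t : R) : R := expmx (t *: G) 0 ord_max / pi 0 ord_max.

Lemma ct_cdf t : 0 <= t -> measurable [set w | (T w <= t%:E)%E] /\
  mu [set w | (T w <= t%:E)%E] = (sst_ct_cdf t)%:E.
Proof.
move=> t0; have [dpi _] := stG.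
apply: (ct_fastest_law dpi _ chainX fastT t0 (pi_gt0 _)) => [s y _|x].
  exact: invariant_expmx.
rewrite -ler_pdivlMr//; exact: generator_ratio_min.
Qed.

Lemma ct_row_ge0 t y : 0 <= t -> 0 <= expmx (t *: G) 0 y <= 1.
Proof.
move=> t0; have [mkX X0] := chainX; have [[_ mF _] FX _] := mkX.
have := ct_law mkX X0 y t0 => muy.
rewrite -!lee_fin -muy measure_ge0 probability_le1//.
exact: mF (FX t y t0).
Qed.

Let T_ge0 w : (0 <= T w)%E. Proof. by have [[F []]] := fastT. Qed.

Lemma measurable_sst : measurable_fun [set: Om] T.
Proof.
apply: (measurability _ (ErealGenOInfty.measurableE R)) => _ [_ [r ->] <-].
rewrite setTI (_ : T @^-1` _ = ~` [set w | (T w <= r%:E)%E]); last first.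
  by apply/seteqP; split=> w /=; rewrite in_itv/= andbT ltNge; move/negP.
apply: measurableC; have [r0|r0] := leP 0 r; first by case: (ct_cdf r0).
rewrite (_ : [set w | _] = set0)//; apply/seteqP; split=> w //= Tr.
by have := le_trans (T_ge0 w) Tr; rewrite lee_fin leNgt r0.
Qed.

(** Fubini for [exp (- u T)], written as the integral of [u exp (- u t)] over
[t >= T]. *)
Lemma laplace_cdf (u : R) : 0 < u ->
  (\int[mu]_w expeR (- (u%:E * T w)) =
   \int[lebesgue_measure]_(t in `[0%R, +oo[) (u * expR (- u * t) * sst_ct_cdf t)%:E)%E.
Proof.
move=> u0; pose k (t : R) : R := u * expR (- u * t).
have k0 t : 0 <= k t by rewrite mulr_ge0 ?expR_ge0// ltW.
have kD (t : R) : is_derive t 1 (fun t => - expR (- u * t)) (k t).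
  by apply: is_derive_eq (is_deriveN (is_derive_expR_scale _ _)) _; rewrite mulNr opprK.
have k_cont : continuous k.
  move=> t; apply: (@is_derive_continuous _ _ (u * (- u * expR (- u * t)))).
  exact: (@is_deriveZ _ _ _ _ u _ _ _ (is_derive_expR_scale (- u) t)).
pose S := [set wt : Om * measurableTypeR R | (T wt.1 <= wt.2%:E)%E].
have mS : measurable S.
  rewrite -[S]setTI; apply: measurable_lee => //.
    by apply: measurableT_comp => //; exact: measurable_sst.
  by apply/measurable_EFinP; exact: measurable_snd.
pose f (wt : Om * measurableTypeR R) := (k wt.2 * \1_S wt)%:E.
have mf : measurable_fun setT f.
  apply/measurable_EFinP; apply: measurable_funM => //.
  apply: measurableT_comp; last exact: measurable_snd.
  exact: continuous_measurable_fun.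
have f0 wt : (0 <= f wt)%E by rewrite lee_fin mulr_ge0.
have := fubini_tonelli (m1 := mu) (m2 := @lebesgue_measure R) f mf f0.
have -> : (\int[mu]_w \int[lebesgue_measure]_t f (w, t) =
    \int[mu]_w expeR (- (u%:E * T w)))%E.
  apply: eq_integral => w _; have := T_ge0 w.
  case Tw : (T w) => [r| |//] r0.
    rewrite lee_fin in r0.
    transitivity (\int[lebesgue_measure]_(t in `[r, +oo[) (k t)%:E)%E.
      rewrite [RHS]integral_mkcond; apply: eq_integral => t _.
      rewrite patchE /f indicE /=; case: ifPn => [/set_mem/=|/negP].
        by rewrite in_itv/= andbT => rt; rewrite mem_set ?mulr1//= /S/= Tw lee_fin.
      move=> rt; rewrite memNset ?mulr0//= /S/= Tw lee_fin => rt'; apply: rt.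
      by rewrite mem_set//= in_itv/= andbT.
    rewrite (integral_derivative_ray _ k_cont kD (l := 0)).
    - by rewrite sub0r opprK -EFinM -EFinN /= mulNr.
    - by move=> x _; exact: k0.
    - by rewrite -oppr0; apply: cvgN; exact: expR_decay.
  rewrite gt0_muley ?lte_fin//= integral0_eq// => t _.
  by rewrite /f indicE memNset ?mulr0//= /S/= Tw.
move=> ->; rewrite [RHS]integral_mkcond; apply: eq_integral => t _.
rewrite patchE; case: ifPn => [/set_mem/=|/negP].
  rewrite in_itv/= andbT => t0; have [mt mut] := ct_cdf t0.
  transitivity (\int[mu]_w ((k t)%:E * (\1_[set w | (T w <= t%:E)%E] w)%:E))%E.
    apply: eq_integral => w _; rewrite -EFinM /f/= !indicE; congr (_ * (nat_of_bool _)%:R)%:E.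
  rewrite ge0_integralZl//=.
  - by rewrite integral_indic// setIT [X in (_ * X)%E]mut -EFinM.
  - exact/measurable_EFinP.
  - by rewrite lee_fin.
move=> t0; rewrite integral0_eq// => w _; rewrite /f indicE memNset ?mulr0//= /S/= => Tt.
apply: t0; rewrite mem_set//= in_itv/= andbT -lee_fin.
exact: le_trans Tt.
Qed.

(** With [w] the last column of [(u - G)^-1], the function
[exp (- u t) * (exp (t G) w)_0] has derivative
[- exp (- u t) * (exp (t G))_(0,d)] and tends to [0] at infinity. *)
Lemma laplace_resolvent (u : R) : 0 < u ->
  (\int[lebesgue_measure]_(t in `[0%R, +oo[) (u * expR (- u * t) * sst_ct_cdf t)%:E =
   (u * invmx (u%:M - G) 0 ord_max / pi 0 ord_max)%:E)%E.
Proof.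
move=> u0; pose w y := invmx (u%:M - G) y ord_max.
have uG := generator_resolvent_unit genG u0.
pose h (t : R) := \sum_y w y * expmx (t *: G) 0 y.
pose a := u / pi 0 ord_max.
have wE l : u * w l - \sum_y G l y * w y = (l == ord_max)%:R.
  have /matrixP/(_ l ord_max) := mulmxV uG; rewrite !mxE => <-.
  rewrite [RHS](eq_bigr (fun y => u * ((l == y)%:R * w y) - G l y * w y)).
    rewrite sumrB -mulr_sumr; congr (_ * _ - _).
    rewrite (bigD1 l)//= eqxx mul1r big1 ?addr0// => y.
    by rewrite eq_sym => /negbTE ->; rewrite mul0r.
  by move=> y _; rewrite !mxE; case: (l == y); rewrite ?mulr1n ?mulr0n /w; ring.
have hD (t : R) : is_derive t 1 h (u * h t - expmx (t *: G) 0 ord_max).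
  have := is_derive_sum_scale (index_enum _) w (fun y => is_derive_expmxr G 0 y t).
  congr (is_derive _ _ _ _).
  rewrite (eq_bigr (fun y => \sum_l G l y * w y * expmx (t *: G) 0 l)); last first.
    by move=> y _; rewrite mulr_sumr; apply: eq_bigr => l _; ring.
  rewrite exchange_big/=.
  rewrite (eq_bigr (fun l => u * (w l * expmx (t *: G) 0 l) -
      (l == ord_max)%:R * expmx (t *: G) 0 l)); last first.
    by move=> l _; rewrite -wE -mulr_suml; ring.
  rewrite sumrB -mulr_sumr; congr (_ - _).
  by rewrite (bigD1 ord_max)//= eqxx mul1r big1 ?addr0// => y /negbTE ->; rewrite mul0r.
pose Phi t := - a * (expR (- u * t) * h t).
have PhiD (t : R) : is_derive t 1 Phi (u * expR (- u * t) * sst_ct_cdf t).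
  have := is_deriveM (is_derive_expR_scale (- u) t) (hD t).
  move/(is_deriveZ (- a)); congr (is_derive _ _ _ _).
  by rewrite /GRing.scale/= /sst_ct_cdf /a; field; rewrite gt_eqF.
have fc : continuous (fun t => u * expR (- u * t) * sst_ct_cdf t).
  have kc : continuous (fun t : R => u * expR (- u * t)).
    move=> t; apply: cvgMl_tmp.
    exact: is_derive_continuous (is_derive_expR_scale (- u) t).
  have cc : continuous sst_ct_cdf.
    move=> t; apply: cvgMr_tmp.
    exact: is_derive_continuous (is_derive_expmxr G 0 ord_max t).
  by move=> t; exact: cvgM (kc t) (cc t).
rewrite (integral_derivative_ray _ fc PhiD (l := 0)).
- congr EFin; rewrite /Phi mulr0 expR0 mul1r sub0r /a /h.
  rewrite (eq_bigr (fun y => w y * (0 == y)%:R)); last first.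
    by move=> y _; rewrite scale0r expmx0.
  rewrite (bigD1 0)//= mulr1 big1 ?addr0.
    by rewrite mulNr opprK /w mulrAC.
  by move=> y; rewrite eq_sym => /negbTE ->; rewrite mulr0.
- move=> t t0; rewrite !mulr_ge0 ?expR_ge0 ?(ltW u0)// ?invr_ge0 ?(ltW (pi_gt0 _))//.
  by have /andP[] := ct_row_ge0 ord_max t0.
- pose C := `|a| * \sum_y `|w y|.
  apply/norm_cvg0P.
  apply: (@squeeze_cvgr _ _ _ _ (cst 0) (fun t => C * expR (- u * t))).
  + near=> t; rewrite normr_ge0/= /Phi normrM normrN [`|_ * h _|]normrM /C.
    rewrite [`|expR _|]ger0_norm ?expR_ge0// -mulrA ler_wpM2l// mulrC.
    rewrite ler_wpM2r ?expR_ge0// (le_trans (ler_norm_sum _ _ _))// ler_sum// => y _.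
    have /andP[e0 e1] : 0 <= expmx (t *: G) 0 y <= 1 by apply: ct_row_ge0.
    by rewrite normrM ler_piMr// ger0_norm.
  + exact: cvg_cst.
  + by rewrite -[X in _ --> X](mulr0 C); apply: cvgMl_tmp; exact: expR_decay.
Unshelve. all: by end_near.
Qed.

Lemma laplace_transform (nu : 'I_d -> R[i]) : eigenvalues (- G) (0 :: codom nu) ->
  forall u : R, 0 <= u ->
    (laplace mu T u)%:C = \prod_(j < d) (nu j / (nu j + u%:C)).
Proof.
move=> chi u u_ge0.
have chi' : char_poly (map_mx (real_complex R) (- G)) =
    'X * \prod_(z <- codom nu) ('X - z%:P) by rewrite chi big_cons subr0.
have [fold c0] := generator_spectral_product genG irrG skG stG
  (etrans (size_codom nu) (card_ord d)) chi'.
have c0' : \prod_(z <- codom nu) z != 0 by apply: contraNneq c0 => ->; rewrite mul0r.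
have [->|u_neq0] := eqVneq u 0.
  rewrite /laplace (eq_integral (cst 1%E)); last first.
    by move=> w _; rewrite mul0e oppe0 expeR0.
  rewrite integral_cst// [X in (_ * X)%E]probability_setT mule1/= big1// => j _.
  rewrite addr0 divff//; apply: contraNneq c0' => nuj.
  by rewrite big_codom (bigD1 j)//= nuj mul0r.
have u0 : 0 < u by rewrite lt_neqAle eq_sym u_neq0.
rewrite /laplace laplace_cdf// laplace_resolvent//=.
have uG := generator_resolvent_unit genG u0.
set f := real_complex R in chi' fold c0 *.
have skC (i j : 'I_d.+1) : (i.+1 < j)%N -> (map_mx f G) i j = 0.
  by move=> ij; rewrite mxE skG// rmorph0.
have piC : map_mx f pi *m map_mx f G = 0 by rewrite -map_mxM piG map_mx0.
have MC : (f u)%:M - map_mx f G = map_mx f (u%:M - G) by rewrite map_mxB map_scalar_mx.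
have uC : (f u)%:M - map_mx f G \in unitmx by rewrite MC map_unitmx.
have fu0 : f u != 0 by rewrite fmorph_eq0.
have sz : (0 + size (codom nu))%N = d by rewrite size_codom card_ord.
have := resolvent_spectral piC skC uC fu0 sz (@supported_delta _ _) fold.
rewrite MC -map_invmx -rowE !mxE => RE.
set D := \prod_(z <- codom nu) (f u + z) in RE.
have D0 : D != 0.
  apply: contraNneq c0 => D0; apply/eqP.
  by rewrite D0 mulr0 mul0r in RE; exact: esym RE.
have fp0 : f (pi 0 ord_max) != 0 by rewrite fmorph_eq0 gt_eqF.
rewrite prodf_div.
have -> : \prod_(j < d) nu j = \prod_(z <- codom nu) z by rewrite big_codom.
have -> : \prod_(j < d) (nu j + f u) = D.
  by rewrite /D big_codom; apply: eq_bigr => j _; rewrite addrC.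
apply: (mulIf fp0); rewrite [RHS]mulrAC -RE [RHS]mulrAC mulfK//.
by rewrite /f -!rmorphM/= divfK ?gt_eqF.
Qed.

End ContinuousConclusion.

(** * Convolutions of exponential laws *)

Section ExponentialIntegral.
Variables (R : realType) (z : R).
Hypothesis z0 : 0 < z.

(** The probability structure of [exponential_prob z] depends on the proof of
[0 < z], which cannot be inferred from [z]; hence a name for the bundled
measure. *)
Definition exponential_law : probability (measurableTypeR R) R.
Proof. by unshelve refine (exponential_prob z). Defined.

Lemma exponential_dominated : exponential_law `<< lebesgue_measure.
Proof.
apply/null_content_dominatesP => A mA A0; rewrite /exponential_law/= /exponential_prob.
apply: null_set_integral => //.
by apply/measurable_funTS/measurable_EFinP; exact: measurable_exponential_pdf.
Qed.

(** The density is the Radon-Nikodym derivative almost everywhere. *)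
Lemma integral_exponential_law (f : measurableTypeR R -> \bar R) :
  measurable_fun [set: measurableTypeR R] f -> (forall x, 0 <= f x <= 1)%E ->
  (\int[exponential_law]_x f x =
   \int[lebesgue_measure]_x (f x * (exponential_pdf z x)%:E))%E.
Proof.
move=> mf f01.
rewrite -(Radon_Nikodym_change_of_variables exponential_dominated)//=; last first.
  apply/integrableP; split=> //.
  apply: (@le_lt_trans _ _ (\int[exponential_law]_x cst 1 x)%E).
    apply: ge0_le_integral => //.
    - exact: measurableT_comp.
    - by move=> x _ /=; have /andP[f0 f1] := f01 x; rewrite gee0_abs.
  by rewrite integral_cst// [X in (_ * X)%E](probability_setT exponential_law) mule1 ltry.
have mpdf : measurable_fun [set: measurableTypeR R] (fun x => (exponential_pdf z x)%:E).
  by apply/measurable_EFinP; exact: measurable_exponential_pdf.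
apply: ae_eq_integral => //.
- apply: emeasurable_funM => //; apply: (measurable_int lebesgue_measure).
  by apply: Radon_Nikodym_integrable; exact: exponential_dominated.
- exact: emeasurable_funM.
- apply: ae_eqe_mul2l => /=.
  rewrite Radon_NikodymE//=; first exact: exponential_dominated.
  move=> abmu; case: cid => /= h [h1 h2 h3].
  by apply: integral_ae_eq => //= E _ mE; rewrite -h3.
Qed.

End ExponentialIntegral.

Section ExponentialConvolution.
Variable R : realType.
Implicit Types (s : seq R).

Definition exponential_convolution s : set R -> \bar R :=
  \big[@convolution R/dirac (0 : R)]_(z <- s) exponential_prob z.

Lemma measurable_sum_preimage (A : set (measurableTypeR R)) : measurable A ->
  measurable [set xy : measurableTypeR R * measurableTypeR R | A (xy.1 + xy.2)].
Proof.
move=> mA; rewrite -[X in measurable X]setTI.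
exact: (measurable_funD measurable_fst measurable_snd measurableT mA).
Qed.

Lemma measurable_translate (A : set R) (x : R) : measurable A ->
  measurable [set y : measurableTypeR R | A (x + y)].
Proof.
move=> mA; rewrite -[X in measurable X]setTI.
exact: (measurable_funD (measurable_cst x) (@measurable_id _ _ _) measurableT mA).
Qed.

Lemma measurable_translated_mass (p : probability (measurableTypeR R) R) (A : set R) :
  measurable A ->
  measurable_fun [set: measurableTypeR R] (fun x => p [set y | A (x + y)]).
Proof.
move=> mA; have := measurable_fun_xsection p (measurable_sum_preimage mA).
apply: eq_measurable_fun => x _ /=; congr (p _).
by apply/seteqP; split=> y; rewrite xsectionE.
Qed.

(** [convolution] integrates over [R] and [exponential_law] lives on
[measurableTypeR R]: the sigma-algebras coincide, but the two structures are
different, and the identity map [iota] transports one integral to the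
other. *)
Lemma convolution_exponentialE z (z0 : 0 < z) (m2 : set R -> \bar R)
    (p : probability (measurableTypeR R) R) (A : set R) :
  (forall A, measurable A -> m2 A = p A) -> measurable A ->
  convolution (exponential_prob z) m2 A =
    (\int[exponential_law z0]_x p [set y | (A (x + y))%R])%E.
Proof.
move=> m2p mA; pose iota (x : measurableTypeR R) : R := x.
have miota : measurable_fun setT iota by move=> _ Y mY; rewrite setTI.
have mf : measurable_fun [set: R] (fun x => p [set y | A (x + y)]).
  by move=> _ Y mY; exact: (measurable_translated_mass p mA measurableT mY).
rewrite /convolution.
have -> : (fun x => m2 [set y | A (x + y)]) = (fun x => p [set y | A (x + y)]).
  by apply/funext => x; exact: m2p (measurable_translate x mA).
transitivity (\int[pushforward (exponential_law z0) iota]_x p [set y | (A (x + y))%R])%E.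
  by [].
by rewrite ge0_integral_pushforward.
Qed.

(** The convolution is the law of a sum of independent variables, hence a
probability on the measurable sets. *)
Lemma exponential_convolutionP s : (forall z, z \in s -> 0 < z) ->
  exists p : probability (measurableTypeR R) R,
    forall A, measurable A -> exponential_convolution s A = p A.
Proof.
elim: s => [|z s IH] s0.
  by exists (dirac (0 : measurableTypeR R)) => A _; rewrite /exponential_convolution big_nil.
have z0 : 0 < z by apply: s0; rewrite mem_head.
have [p pE] : exists p : probability (measurableTypeR R) R,
    forall A, measurable A -> exponential_convolution s A = p A.
  by apply: IH => y ys; apply: s0; rewrite in_cons ys orbT.
pose add (xy : measurableTypeR R * measurableTypeR R) : measurableTypeR R := xy.1 + xy.2.
have madd : measurable_fun setT add by exact: measurable_funD.
pose q : probability (measurableTypeR R * measurableTypeR R)%type R :=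
  (exponential_law z0 \x p)%E.
pose X : {mfun (measurableTypeR R * measurableTypeR R)%type >-> measurableTypeR R} :=
  mfun_Sub (mem_set madd).
exists (distribution q X) => A mA.
rewrite /exponential_convolution big_cons -/(exponential_convolution s).
rewrite (convolution_exponentialE z0 pE mA).
transitivity ((exponential_law z0 \x p)%E
  [set xy : measurableTypeR R * measurableTypeR R | A (xy.1 + xy.2)]); last by [].
rewrite /product_measure1; apply: eq_integral => x _ /=; congr (p _).
by apply/seteqP; split=> y; rewrite xsectionE.
Qed.

Lemma exponential_convolution_cons z (z0 : 0 < z) s (A : set R) :
  (forall y, y \in s -> 0 < y) -> measurable A ->
  exponential_convolution (z :: s) A =
    (\int[lebesgue_measure]_x (exponential_convolution s [set y | (A (x + y))%R] *
      (exponential_pdf z x)%:E))%E.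
Proof.
move=> s0 mA; have [p pE] := exponential_convolutionP s0.
rewrite /exponential_convolution big_cons -/(exponential_convolution s).
rewrite (convolution_exponentialE z0 pE mA) integral_exponential_law//.
- by apply: eq_integral => x _; rewrite pE//; exact: measurable_translate.
- exact: measurable_translated_mass.
- by move=> x; rewrite measure_ge0 probability_le1//; exact: measurable_translate.
Qed.

End ExponentialConvolution.

Section ExponentialCdf.
Variables (R : realType) (d : nat) (G : 'M[R]_d.+1) (pi : 'rV[R]_d.+1).
Hypothesis piG : pi *m G = 0.
Hypothesis skipG : forall i j : 'I_d.+1, (i.+1 < j)%N -> G i j = 0.

Definition semigroup_entry (v : 'rV[R]_d.+1) (t : R) : R :=
  \sum_y v 0 y * expmx (t *: G) y ord_max.

(** [v G exp (t G)] is the derivative of [v exp (t G)], and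
[v G = spectral_step G v z - z v]. *)
Lemma is_derive_semigroup_entry v z (t : R) :
  is_derive t 1 (semigroup_entry v)
    (semigroup_entry (spectral_step G v z) t - z * semigroup_entry v t).
Proof.
have := is_derive_sum_scale (index_enum _) (v 0)
  (fun y => is_derive_expmxl G y ord_max t).
congr (is_derive _ _ _ _); rewrite /semigroup_entry.
rewrite (eq_bigr (fun y => \sum_l v 0 y * G y l * expmx (t *: G) l ord_max)); last first.
  by move=> y _; rewrite mulr_sumr; apply: eq_bigr => l _; rewrite mulrA.
rewrite exchange_big/= mulr_sumr -sumrB; apply: eq_bigr => l _.
have -> : spectral_step G v z 0 l = \sum_y v 0 y * G y l + z * v 0 l.
  by rewrite spectral_stepE !mxE.
by rewrite -mulr_suml; ring.
Qed.

(** Let [h] and [h'] be the entries at [d] of [v exp (t G)] and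
[v (G + z) exp (t G)]. The equation [h' = dh/dt + z h] with [h 0 = 0] has the
solution [h t = int_0^t exp (- z x) h' (t - x) dx], the convolution with an
exponential density up to the factor [z]. *)
Lemma exponential_convolution_cdf (c : R) (s : seq R) (v : 'rV[R]_d.+1) k :
  (forall z, z \in s -> 0 < z) -> (k + size s)%N = d -> supported_up_to v k ->
  foldl (spectral_step G) v s = c *: pi -> c * pi 0 ord_max != 0 ->
  forall t, exponential_convolution s `]-oo, t]%classic =
    (if 0 <= t then (\prod_(z <- s) z) * semigroup_entry v t / (c * pi 0 ord_max)
     else 0)%:E.
Proof.
move=> + + + + c0; elim: s v k => [|z s IH] v k s0 /=.
  move=> _ _ -> t; rewrite /exponential_convolution !big_nil diracE.
  have -> : semigroup_entry (c *: pi) t = c * pi 0 ord_max.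
    rewrite /semigroup_entry -(invariant_expmx piG t) mulr_sumr.
    by apply: eq_bigr => y _; rewrite mxE mulrA.
  rewrite mul1r divff//; case: ifPn => t0.
    by rewrite mem_set//= in_itv.
  by rewrite memNset//= in_itv/=; exact/negP.
move=> ksz vk fold t.
have z0 : 0 < z by apply: s0; rewrite mem_head.
have s0' y : y \in s -> 0 < y by move=> ys; apply: s0; rewrite in_cons ys orbT.
have ksz' : (k.+1 + size s)%N = d by rewrite addSnnS.
have {}IH := IH _ k.+1 s0' ksz' (supported_step skipG _ vk) fold.
have vd : v 0 ord_max = 0 by apply: vk => /=; move: ksz; lia.
have v0 : semigroup_entry v 0 = 0.
  rewrite /semigroup_entry (bigD1 ord_max)//= vd mul0r big1 ?addr0// => y yd.
  by rewrite scale0r expmx0 (negbTE yd) mulr0.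
rewrite exponential_convolution_cons//.
have shift (x : R) : [set y : R | (`]-oo, t]%classic (x + y)%R : Prop)] = `]-oo, t - x]%classic.
  by apply/seteqP; split=> y /=; rewrite !in_itv/= lerBrDl.
set v' := spectral_step G v z in IH fold.
pose a := (\prod_(z <- s) z) / (c * pi 0 ord_max).
pose g (x : R) := z * a * (expR (- z * x) * semigroup_entry v' (t - x)).
have integrandE (x : R) : (exponential_convolution s [set y : R | (`]-oo, t]%classic (x + y)%R : Prop)] *
    (exponential_pdf z x)%:E)%E = (if 0 <= x <= t then g x else 0)%:E.
  rewrite shift IH subr_ge0 -EFinM; have [x0|x0] := leP 0 x; last first.
    by rewrite lt0_exponential_pdf// mulr0.
  rewrite exponential_pdfE//; case: ifP => xt; last by rewrite mul0r.
  by rewrite /g /a; congr EFin; ring.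
have [t0|t0] := leP 0 t; last first.
  rewrite integral0_eq// => x _; rewrite integrandE.
  by case: ifP => // /andP[x0 /(le_trans x0)]; rewrite leNgt t0.
transitivity (\int[lebesgue_measure]_(x in `[0%R, t]) (g x)%:E)%E.
  rewrite [RHS]integral_mkcond; apply: eq_integral => x _; rewrite integrandE patchE.
  by rewrite mem_setE in_itv/=; case: ifP.
(* An antiderivative of g, which vanishes at x = t. *)
pose Phi (x : R) := - (z * a) * (expR (- z * x) * semigroup_entry v (t - x)).
have rev (w : 'rV[R]_d.+1) y (x : R) : is_derive x 1 (fun x => semigroup_entry w (t - x))
    (y * semigroup_entry w (t - x) - semigroup_entry (spectral_step G w y) (t - x)).
  have lin : is_derive x 1 (fun x : R => t - x) (- 1).
    apply: is_derive_eq (is_deriveB (is_derive_cst t x 1) (is_derive_id x 1)) _.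
    by rewrite sub0r.
  have := @is_derive1_comp R (semigroup_entry w) (fun x : R => t - x) x _ _
    (is_derive_semigroup_entry w y (t - x)) lin.
  by congr (is_derive _ _ _ _); rewrite mulrN1 opprB.
have PhiD (x : R) : is_derive x 1 Phi (g x).
  have := is_deriveM (is_derive_expR_scale (- z) x) (rev v z x).
  move/(is_deriveZ (- (z * a))); congr (is_derive _ _ _ _).
  by rewrite /GRing.scale/= /g; ring.
have gc : continuous g.
  move=> x; apply: cvgMl_tmp; apply: cvgM.
    exact: is_derive_continuous (is_derive_expR_scale (- z) x).
  exact: is_derive_continuous (rev v' 0 x).
rewrite (integral_derivative_segment t0 gc PhiD); congr EFin.
rewrite /Phi subrr v0 mulr0 mulr0 sub0r mulr0 expR0 subr0 big_cons /a.
by ring.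
Qed.

End ExponentialCdf.

(** * The continuous-time law *)

Section ContinuousLaw.
Variables (R : realType) (d : nat) (G : 'M[R]_d.+1) (pi : 'rV[R]_d.+1).
Hypothesis genG : is_generator G.
Hypothesis irrG : irreducible G.
Hypothesis skG : skip_free G.
Hypothesis stG : stationary_generator G pi.
Hypothesis monG : stochastically_monotone_generator (time_reversal pi G).
Context (dO : measure_display) (Om : measurableType dO)
  (mu : probability Om R) (X : R -> Om -> 'I_d.+1) (T : Om -> \bar R).
Hypothesis chainX : ct_chain_from0 G mu X.
Hypothesis fastT : ct_fastest_sst G pi mu X T.

(** No [z] in [s] vanishes, because their product does not, and a negative one would
make [- z - G] singular with [- z > 0]. *)
Lemma real_eigenvalue_gt0 (s : seq R) : size s = d ->
  char_poly (- G) = 'X * \prod_(z <- s) ('X - z%:P) ->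
  forall z, z \in s -> 0 < z.
Proof.
move=> sz chi z zs.
have [_ c0] := generator_spectral_product (f := idfun) genG irrG skG stG sz
  (etrans (congr1 _ (map_mx_id (fun=> erefl) _)) chi).
have z_neq0 : z != 0.
  apply: contraNneq c0 => z0; rewrite (perm_big _ (perm_to_rem zs)) big_cons.
  by rewrite z0 /= !mul0r.
rewrite lt_neqAle eq_sym z_neq0 leNgt; apply/negP => zlt0.
have uG : (- z)%:M - G \in unitmx by rewrite generator_resolvent_unit// oppr_gt0.
have /eigenvalueP[v vG v0] : eigenvalue (- G) z.
  by rewrite eigenvalue_root_char chi rootM root_prod_XsubC zs orbT.
case/negP: v0; apply/eqP; rewrite -[v]mulmx1 -(mulmxV uG) mulmxA.
have -> : v *m ((- z)%:M - G) = 0.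
  by rewrite mulmxDr vG mul_mx_scalar scaleNr addNr.
by rewrite mul0mx.
Qed.

(** Both sides are finite measures in [A], and they agree on all rays
[]-oo, t]]. *)
Lemma law_convolution (nu : 'I_d -> R[i]) (r : 'I_d -> R) :
  eigenvalues (- G) (0 :: codom nu) -> (forall j, nu j = (r j)%:C) ->
  forall A : set R, measurable A ->
    mu (T @^-1` (EFin @` A)) =
    (\big[@convolution R/dirac (0 : R)]_(j < d) exponential_prob (r j)) A.
Proof.
move=> ev nur; have chi := real_char_poly ev nur.
have sz : size (codom r) = d by rewrite size_codom card_ord.
have pos := real_eigenvalue_gt0 sz chi.
have [fold c0] := generator_spectral_product (f := idfun) genG irrG skG stG sz
  (etrans (congr1 _ (map_mx_id (fun=> erefl) _)) chi).
rewrite !map_mx_id// in fold.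
have [_ piG] := stG.
have cdf t : exponential_convolution (codom r) `]-oo, t]%classic =
    (if 0 <= t then sst_ct_cdf G pi t else 0)%:E.
  have sz0 : (0 + size (codom r))%N = d by [].
  rewrite (exponential_convolution_cdf piG skG pos sz0 (@supported_delta _ _) fold c0).
  case: ifP => // _; congr EFin; rewrite /sst_ct_cdf /semigroup_entry.
  have -> : \sum_y (delta_mx 0 0 : 'rV[R]_d.+1) 0 y * expmx (t *: G) y ord_max =
      expmx (t *: G) 0 ord_max.
    rewrite (bigD1 0)//= big1 ?addr0; first by rewrite mxE eqxx mul1r.
    by move=> y y0; rewrite [delta_mx _ _ _ _]mxE (negbTE y0) mul0r.
  have := c0; rewrite mulf_eq0 negb_or => /andP[r0 p0].
  by rewrite invfM mulrACA divff// mul1r.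
have [p pE] := exponential_convolutionP pos.
have mT := measurable_sst genG irrG stG monG chainX fastT.
have T0 w : (0 <= T w)%E by have [[F []]] := fastT.
pose D := [set w | T w \is a fin_num].
have mD : measurable D.
  have -> : D = ~` (setT `&` T @^-1` [set +oo%E]).
    rewrite setTI; apply/seteqP; split=> w /=; rewrite /D/= fin_numE.
      by move=> /andP[_ /eqP].
    by move=> /eqP ->; rewrite andbT; apply: contraTneq (T0 w) => ->.
  by apply: measurableC; exact: mT.
pose phi (w : Om) : measurableTypeR R := fine (T w).
have mphi : measurable_fun setT phi by apply: measurableT_comp mT.
(* The law of T restricted to the event that T is finite. *)
have [m mE] : exists m : {measure set (measurableTypeR R) -> \bar R},
    forall A, m A = mu (T @^-1` (EFin @` A)).
  unshelve eexists; first by unshelve refine (pushforward (mrestr mu mD) phi).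
  move=> A; rewrite /= /pushforward /mrestr; congr (mu _).
  apply/seteqP; split=> w /=.
    by move=> [Aw Dw]; exists (fine (T w)) => //; rewrite fineK.
  by move=> [x Ax Tx]; rewrite /phi /D/= -Tx.
have mray t : m `]-oo, t]%classic = p `]-oo, t]%classic.
  rewrite mE -pE; last exact: measurable_itv.
  rewrite cdf; case: ifPn => t0.
    rewrite -(ct_cdf genG irrG stG monG chainX fastT t0).2; congr (mu _).
    apply/seteqP; split=> w /=.
      by move=> [x]; rewrite in_itv/= => xt <-; rewrite lee_fin.
    move=> Tt; have Tf : T w \is a fin_num.
      by rewrite ge0_fin_numE// (le_lt_trans Tt)// ltry.
    by exists (fine (T w)); rewrite ?fineK// in_itv/= -lee_fin fineK.
  rewrite (_ : T @^-1` _ = set0) ?measure0//; apply/seteqP; split=> w //= [x].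
  rewrite in_itv/= => xt Tx; have := T0 w; rewrite -Tx lee_fin => x0.
  by case/negP: t0; exact: le_trans xt.
have mp : forall A : set R, measurable A -> m A = p A.
  move=> A mA; apply: (@measure_unique _ R (measurableTypeR R) [set X | ocitv X]
    (fun n => `](- n%:R), n%:R]%classic)) => //.
  - exact: ocitvI.
  - by move=> n; exact: is_ocitv.
  - apply/seteqP; split=> // x _; exists (Num.truncn `|x|).+1 => //=.
    have := truncnS_gt `|x|; rewrite ltr_norml in_itv/= => /andP[-> /ltW ->].
    by [].
  - move=> _ [[a b]/= _ <-].
    have [ab|ba] := leP a b; last first.
      by rewrite set_itv_ge ?measure0// bnd_simp -leNgt ltW.
    have -> : `]a, b]%classic = `]-oo, b] `\` `]-oo, a] :> set R.
      by rewrite -[RHS]setCK setCD setCitvl setUC -[LHS]setCK setCitv.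
    have sub : `]-oo, a] `<=` `]-oo, b] by exact: subset_itvl.
    have fin_ray : (m `]-oo, b]%classic < +oo)%E by rewrite mray -ge0_fin_numE// fin_num_measure.
    transitivity (m `]-oo, b]%classic - m `]-oo, a]%classic)%E.
      by rewrite measureD ?setIidr//; exact: measurable_itv.
    rewrite !mray; symmetry; rewrite measureD ?setIidr//; try exact: measurable_itv.
    by rewrite -ge0_fin_numE// fin_num_measure.
  - move=> n; rewrite (le_lt_trans _ (_ : m `]-oo, n%:R]%classic < +oo)%E)//.
      apply: le_measure; rewrite ?inE; try exact: measurable_itv.
      by move=> x /=; rewrite !in_itv/= => /andP[].
    by rewrite mray -ge0_fin_numE// fin_num_measure.
move=> A mA; rewrite -mE mp// -pE// /exponential_convolution.
by rewrite big_codom.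
Qed.

End ContinuousLaw.

(** * Laplace transform, generating function and laws *)

Theorem theorem1p4 (R : realType) (d : nat) :
  (forall (G : 'M[R]_d.+1) (pi : 'rV[R]_d.+1)
     (dO : measure_display) (Om : measurableType dO) (mu : probability Om R)
     (X : R -> Om -> 'I_d.+1) (T : Om -> \bar R) (nu : 'I_d -> R[i]),
     is_generator G -> irreducible G -> skip_free G ->
     stationary_generator G pi ->
     stochastically_monotone_generator (time_reversal pi G) ->
     ct_chain_from0 G mu X ->
     ct_fastest_sst G pi mu X T ->
     eigenvalues (- G) (0 :: codom nu) ->
     (forall u : R, 0 <= u ->
        (laplace mu T u)%:C = \prod_(j < d) (nu j / (nu j + u%:C))) /\
     (forall r : 'I_d -> R, (forall j, nu j = (r j)%:C) ->
        forall A : set R, measurable A ->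
          mu (T @^-1` (EFin @` A)) =
          (\big[@convolution R/dirac (0 : R)]_(j < d) exponential_prob (r j)) A))
  /\
  (forall (P : 'M[R]_d.+1) (pi : 'rV[R]_d.+1)
     (dO : measure_display) (Om : measurableType dO) (mu : probability Om R)
     (X : nat -> Om -> 'I_d.+1) (T : Om -> option nat) (theta : 'I_d -> R[i]),
     is_transition_matrix P -> irreducible P -> aperiodic P -> skip_free P ->
     stationary P pi ->
     stochastically_monotone (time_reversal pi P) ->
     dt_chain_from0 P mu X ->
     dt_fastest_sst P pi mu X T ->
     eigenvalues P (1 :: codom theta) ->
     (forall u : R[i], `|u| < 1 ->
        pgf mu T u =
        \prod_(j < d) ((1 - theta j) * u / (1 - theta j * u))) /\
     (forall q : 'I_d -> R, (forall j, theta j = (q j)%:C) ->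
        (forall j, 0 <= q j) ->
        forall k : nat,
          mu [set w | T w = Some k] =
          ((\big[@pmf_convolution R/@pmf_dirac0 R]_(j < d)
              geometric_pmf (1 - q j)) k)%:E)).
Proof.
split.
- move=> G pi dO Om mu X T nu genG irrG skG stG monG chainX fastT ev; split.
    exact: (laplace_transform genG irrG skG stG monG chainX fastT ev).
  move=> r nur A mA.
  exact: (law_convolution genG irrG skG stG monG chainX fastT ev nur mA).
- move=> P pi dO Om mu X T theta trP irrP _ skP stP monP chainX fastT ev; split.
    exact: (probability_generating_function trP irrP skP stP monP chainX fastT ev).
  move=> q thetaq _ k.
  exact: (geometric_convolution trP irrP skP stP monP chainX fastT ev thetaq).
Qed.
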